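(* Let $(T,X)$ be a minimal weakly almost periodic semiflow on a compact Hausdorff space $X$ with $T$ a right C-semigroup, such that for each $t\in T$ the map $x\mapsto tx$ is a surjection of $X$ onto itself. Then $(T,X)$ is uniquely ergodic.
   Context: $X$ is a compact Hausdorff space. A semiflow $(T,X)$ consists of a topological semigroup $T$ with neutral element $e$ and a jointly continuous map $T\times X\to X$, $(t,x)\mapsto tx$, with $ex=x$ and $(ts)x=t(sx)$ for all $s,t\in T$, $x\in X$. A topological semigroup $T$ is a right C-semigroup if for every $s\in T$ the set $T\setminus Ts$ is relatively compact in $T$. $(T,X)$ is minimal if every orbit $Tx=\{tx:t\in T\}$, $x\in X$, is dense in $X$. $(T,X)$ is weakly almost periodic if for every $f\in C(X,\mathbb{R})$ the set $Tf=\{f_t : t\in T\}$, where $f_t(x)=f(tx)$, is relatively compact in $C(X,\mathbb{R})$ with the topology of pointwise convergence. A Borel probability measure $\mu$ on $X$ is invariant for $(T,X)$ if $\mu(B)=\mu(t^{-1}B)$ for all Borel subsets $B$ of $X$ and all $t\in T$, where $t^{-1}B=\{x\in X: tx\in B\}$. $(T,X)$ is uniquely ergodic if there is exactly one invariant Borel probability measure on $X$. *)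

(* Defs.v *)
From HB Require Import structures.
From mathcomp Require Import all_boot all_order all_algebra.
From mathcomp Require Import all_classical all_reals all_analysis.

Set Implicit Arguments.
Unset Strict Implicit.
Unset Printing Implicit Defensive.

Import numFieldNormedType.Exports.

Local Open Scope classical_set_scope.

HB.mixin Record isTopologicalMonoid T of Topological T & Monoid T := {
  mulg_continuous : continuous (fun p : T * T => (p.1 * p.2)%g)
}.

#[short(type="topologicalMonoidType")]
HB.structure Definition TopologicalMonoid :=
  {T of Topological T & Monoid T & isTopologicalMonoid T}.

(* [precompact] means relatively compact (the closure is compact). *)
Definition right_C_semigroup (T : topologicalMonoidType) : Prop :=
  forall s : T, precompact (~` [set (t * s)%g | t in [set: T]]).

Record semiflow (T : topologicalMonoidType) (X : topologicalType) := Semiflow {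
  act :> T -> X -> X;
  act_jointly_continuous : continuous (fun p : T * X => act p.1 p.2);
  act1 : forall x : X, act 1%g x = x;
  actM : forall (t s : T) (x : X), act (t * s)%g x = act t (act s x)
}.

Section SemiflowProperties.
Context (T : topologicalMonoidType) (X : topologicalType) (S : semiflow T X).

Definition orbit (x : X) : set X := [set S t x | t in [set: T]].

Definition minimal : Prop := forall x : X, dense (orbit x).

Lemma act_continuous (t : T) : continuous (S t).
Proof.
move=> x; apply: (@continuous_comp _ _ _ (fun y => (t, y)) (fun p => S p.1 p.2)).
  by apply: cvg_pair => //=; exact: cvg_cst.
exact: act_jointly_continuous.
Qed.

HB.instance Definition _ (t : T) :=
  isContinuous.Build X X (S t) (act_continuous (t := t)).

Definition translate (R : realType) (f : continuousType X R) (t : T) :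
  continuousType X R := f \o S t.

(* C(X, R) with the topology of pointwise convergence. *)
Definition Cp (R : realType) : topologicalType :=
  initial_topology (fun f : continuousType X R => (f : {ptws X -> R})).

Definition weakly_almost_periodic (R : realType) : Prop :=
  forall f : continuousType X R,
    precompact ([set translate f t | t in [set: T]] : set (Cp R)).

End SemiflowProperties.

(* Measurable types are pointed in the library, hence [ptopologicalType]. *)
Notation borel X := (g_sigma_algebraType (@open X)).

Section UniqueErgodicity.
Context (T : topologicalMonoidType) (X : ptopologicalType) (S : semiflow T X).
Context (R : realType).

Definition invariant_probability (mu : probability (borel X) R) : Prop :=
  forall (t : T) (B : set (borel X)), measurable B -> mu B = mu (S t @^-1` B).

(* A [probability] is a function on all subsets, whose values off the
   sigma-algebra are irrelevant: measures are identified when they agree on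
   the Borel sets, which [exists!] would not do. *)
Definition uniquely_ergodic : Prop :=
  exists2 mu : probability (borel X) R, invariant_probability mu &
    forall nu : probability (borel X) R, invariant_probability nu ->
      forall B : set (borel X), measurable B -> nu B = mu B.

End UniqueErgodicity.

(* Main.v *)
(** Namioka's argument shows that weak almost periodicity yields, for each
    continuous [f] and [eps], a nonempty open set on which the translates [f_t]
    all oscillate by at most [eps]. Minimality carries it to a neighbourhood of
    any point for the times in some [T s], and the remaining times lie in a
    compact set, where joint continuity suffices: so the semiflow is
    equicontinuous. A surjective nonexpansive map of a compact space is an
    isometry, so the topology of [X] is given by [T]-invariant pseudometrics,
    and their common isometries form a compact group acting transitively.

    Haar's covering-number construction gives a regular Borel probability
    [lam] invariant under all these isometries. Averaging continuous functions
    shows that every invariant Borel probability has the same integrals of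
    continuous functions as [lam]. As such a measure is not assumed to be
    regular, one still has to prove that it agrees with [lam] on open sets;
    this is the Kakutani-Kodaira completion regularity of [lam]. *)

Require Import Defs.
From HB Require Import structures.
From mathcomp Require Import all_boot all_order all_algebra.
From mathcomp Require Import all_classical all_reals all_analysis.
From mathcomp Require Import measurable_realfun.
From mathcomp Require Import ring lra.

Set Implicit Arguments.
Unset Strict Implicit.
Unset Printing Implicit Defensive.

Import Order.TTheory GRing.Theory Num.Theory.
Import numFieldNormedType.Exports.

Local Open Scope classical_set_scope.
Local Open Scope ring_scope.

(** * Fragmentability of pointwise compact families *)

Lemma ultra_fmap (I J : Type) (f : I -> J) (F : set_system I) :
  UltraFilter F -> UltraFilter (f @ F).
Proof.
move=> UF; split; first exact: fmap_proper_filter.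
move=> G PG FG; apply/seteqP; split => // A GA.
have [//|FnA] := in_ultra_setVsetC (f @^-1` A) UF.
have /filter_ex[x []//] : G (A `&` ~` A) by apply: filterI => //; exact: FG.
Qed.

Lemma compact_ultra_cvg (X : topologicalType) (G : set_system X) :
  compact [set: X] -> UltraFilter G -> exists y : X, G --> y.
Proof.
move=> + UG; rewrite compact_ultra => /(_ G UG filterT) [y [_ Gy]].
by exists y.
Qed.

(** Otherwise the sets [B L] generate a proper filter. A finer ultrafilter contains a set [A] of
    mutually related indices and, for [i] in [A], the set of indices not related to [i]; these
    cannot meet. *)
Lemma ultra_net (I : choiceType) (r : I -> I -> Prop) :
  (forall G : set_system I, UltraFilter G ->
     exists2 A, G A & forall i j, A i -> A j -> r i j) ->
  exists L : seq I, forall i, exists2 j, j \in L & r i j.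
Proof.
move=> rG; apply: contrapT => noL.
pose B (L : seq I) : set I := [set i | forall j, j \in L -> ~ r i j].
have BL0 L : B L !=set0.
  apply: contrapT => BL; apply: noL; exists L => i; apply: contrapT => ri.
  by apply: BL; exists i => j jL rij; apply: ri; exists j.
have FF : ProperFilter (filter_from [set: seq I] B).
  apply: filter_from_proper => [|L _]; last exact: BL0.
  apply: filter_from_filter; first by exists [::].
  move=> L1 L2 _ _; exists (L1 ++ L2) => // i Bi; split=> j jL; apply: Bi;
  by rewrite mem_cat jL ?orbT.
have [G [UG FG]] := ultraFilterLemma FF.
have [A GA rA] := rG G UG.
have [i Ai] := filter_ex GA.
have GB : G (B [:: i]) by apply: FG; exists [:: i].
have [j [Aj Bj]] := filter_ex (filterI GA GB).
by apply: (Bj i); [rewrite mem_head|exact: rA].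
Qed.

(** A free ultrafilter contains both [A] and every tail, so [A] has two members in increasing order;
    this is the source of recurrence. *)
Lemma ultra_pair (r : nat -> nat -> Prop) :
  (forall G : set_system nat, UltraFilter G ->
     exists2 A, G A & forall i j, A i -> A j -> r i j) ->
  exists m n, (m < n)%N /\ r m n.
Proof.
move=> rG; have [G [UG FG]] := ultraFilterLemma eventually_filter.
have [A GA rA] := rG G UG.
have [m Am] := filter_ex GA.
have Gm : G [set n | (m < n)%N] by apply: FG; exists m.+1.
have [n [An /= mn]] := filter_ex (filterI GA Gm).
by exists m, n; split => //; exact: rA.
Qed.

Section fragmentability.
Context (R : realType) (X : topologicalType) (I : choiceType).
Variable F : I -> X -> R.
Hypothesis cptX : compact [set: X].
Hypothesis contF : forall i, continuous (F i).
(** Relative compactness of the family in [C(X)] for pointwise convergence, phrased with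
    ultrafilters on the index set. *)
Hypothesis limF : forall G : set_system I, UltraFilter G ->
  exists2 g : X -> R, continuous g & forall x, F i x @[i --> G] --> g x.

Lemma family_net (xs : seq X) (e : R) : 0 < e ->
  exists L : seq I, forall i, exists2 j, j \in L &
    forall x, x \in xs -> `|F i x - F j x| < e.
Proof.
move=> e0; apply: ultra_net => G UG.
have [g _ Gg] := limF UG.
have e20 : 0 < e / 2 by rewrite divr_gt0.
exists [set i | forall x, x \in xs -> `|F i x - g x| < e / 2].
  elim: xs => [|x xs IH]; first by apply: filterS filterT => i _ x.
  have Gx : G [set i | `|F i x - g x| < e / 2].
    have /cvgrPdist_lt /(_ _ e20) := Gg x.
    by apply: filterS => i /=; rewrite distrC.
  apply: filterS (filterI Gx IH) => i [/= ix ixs] y.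
  by rewrite inE => /orP[/eqP->//|/ixs].
move=> i j Gi Gj x xxs; rewrite (le_lt_trans (ler_distD (g x) _ _))//.
by rewrite [ltRHS]splitr ltrD ?Gi// distrC Gj.
Qed.

Lemma open_dist_lt (h : X -> R) (a : R) (e : R) : continuous h ->
  open [set x | `|h x - a| < e].
Proof.
move=> ch; apply: (@open_comp _ _ (fun x => `|h x - a|) [set y | y < e]).
  move=> x _; apply: (@continuous_comp _ _ _ (fun x => h x - a) Num.norm).
    by apply: cvgB; [exact: ch|exact: cvg_cst].
  exact: norm_continuous.
exact: open_lt.
Qed.

Lemma open_dist_gt (h : X -> R) (e : R) : continuous h ->
  open [set x | e < `|h x|].
Proof.
move=> ch; apply: (@open_comp _ _ (fun x => `|h x|) [set y | e < y]).
  by move=> x _; apply: (@continuous_comp _ _ _ h Num.norm);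
     [exact: ch|exact: norm_continuous].
exact: open_gt.
Qed.

Lemma shrink_osc (L : seq I) (V : set X) (e : R) : 0 < e ->
  open V -> V !=set0 -> exists U, [/\ open U, U !=set0, U `<=` V &
    forall i, i \in L -> forall a b, U a -> U b -> `|F i a - F i b| < e].
Proof.
move=> e0 oV [x Vx].
exists (V `&` [set y | forall i, i \in L -> `|F i y - F i x| < e / 2]).
have e20 : 0 < e / 2 by rewrite divr_gt0.
split.
- apply: openI => //; elim: L => [|i L IH].
    by rewrite (_ : mkset _ = setT)//; [exact: openT|exact/seteqP].
  rewrite (_ : mkset _ = [set y | `|F i y - F i x| < e / 2] `&`
      [set y | forall i, i \in L -> `|F i y - F i x| < e / 2]).
    by apply: openI => //; exact: open_dist_lt.
  apply/seteqP; split=> [y /= H|y [/= H1 H2] j].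
    by split=> [|j jL]; apply: H; rewrite inE ?eqxx ?jL ?orbT.
  by rewrite inE => /orP[/eqP->//|/H2].
- by exists x; split => //= i _; rewrite subrr normr0.
- by move=> y [].
- move=> i iL a b [_ Ha] [_ Hb]; rewrite (le_lt_trans (ler_distD (F i x) _ _))//.
  by rewrite [ltRHS]splitr ltrD ?Ha// distrC Hb.
Qed.

(* Otherwise one builds indices [s n], [t n] and points [x n] such that
   [F (s n) - F (t n)] tends to 0 at each [x i] but stays away from 0 on
   the tail of [x]: cluster points of the three sequences are contradictory. *)
Lemma fragmented (x0 : X) (e : R) : 0 < e ->
  exists U, [/\ open U, U !=set0 &
    forall i a b, U a -> U b -> `|F i a - F i b| <= e].
Proof.
move=> e0; apply: contrapT => noU.
have e30 : 0 < e / 3 by rewrite divr_gt0.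
(* The state [p] holds the points chosen so far and the current open set; [q] packs two new indices,
   the next point and a smaller open set. *)
have step (p : seq X * set X) : exists q : I * I * X * set X,
    open p.2 -> p.2 !=set0 ->
    [/\ forall x, x \in p.1 ->
          `|F q.1.1.1 x - F q.1.1.2 x| < (size p.1).+1%:R^-1,
        open q.2, q.2 q.1.2 , q.2 `<=` p.2 &
        forall x, q.2 x -> e / 3 < `|F q.1.1.1 x - F q.1.1.2 x| ].
  have [i0] : exists i0 : I, True.
    apply: contrapT => noI; apply: noU; exists setT; split; first exact: openT.
      by exists x0.
    by move=> i; exfalso; apply: noI; exists i.
  move=> _; have [oV|] := pselect (open p.2); last by exists (i0, i0, x0, p.2).
  have [nV|] := pselect (p.2 !=set0); last by exists (i0, i0, x0, p.2).
  apply: contrapT => noq.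
  (* If the construction is stuck, closeness on the finite list forces closeness within [e / 3] on
     the whole open set; a finite net of indices then yields a smaller open set contradicting
     [noU]. *)
  have close i j : (forall x, x \in p.1 ->
        `|F i x - F j x| < (size p.1).+1%:R^-1) ->
      forall x, p.2 x -> `|F i x - F j x| <= e / 3.
    move=> ij x Vx; rewrite leNgt; apply/negP => exij; apply: noq.
    exists (i, j, x, p.2 `&` [set y | e / 3 < `|F i y - F j y|]) => _ _.
    split => //=; last by move=> y [].
    apply: openI => //; apply: (@open_dist_gt (fun y => F i y - F j y)).
    by move=> y; apply: cvgB; exact: contF.
  have [|L Lnet] := @family_net p.1 (size p.1).+1%:R^-1; first by rewrite invr_gt0.
  have [U [oU U0 UV UL]] := shrink_osc L e30 oV nV.
  apply: noU; exists U; split => // i a b Ua Ub.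
  have [j jL ij] := Lnet i.
  have Ha := close _ _ ij _ (UV _ Ua); have Hb := close _ _ ij _ (UV _ Ub).
  have Hj := UL _ jL _ _ Ua Ub.
  have -> : F i a - F i b = (F i a - F j a) - (F i b - F j b) + (F j a - F j b).
    by ring.
  rewrite (le_trans (ler_normD _ _))// (le_trans (lerD (ler_normB _ _) (lexx _)))//.
  by lra.
have [st stP] := choice step.
pose nxt (p : seq X * set X) := (rcons p.1 (st p).1.2, (st p).2).
pose P n := iter n nxt ([::], setT).
pose x n := (st (P n)).1.2; pose s n := (st (P n)).1.1.1.
pose t n := (st (P n)).1.1.2.
have PV n : open (P n).2 /\ (P n).2 !=set0.
  elim: n => [|n [oV V0]]; first by split; [exact: openT|exists x0].
  have [_ oq qx _ _] := stP (P n) oV V0.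
  by split => //; exists (st (P n)).1.2.
have Psz n : size (P n).1 = n.
  by elim: n => //= n IH; rewrite size_rcons IH.
have xP n k : (k < n)%N -> x k \in (P n).1.
  elim: n => // n IH; rewrite ltnS leq_eqVlt => /orP[/eqP->|/IH].
    by rewrite /= mem_rcons mem_head.
  by rewrite /= mem_rcons inE => ->; rewrite orbT.
have Vdec n k : (n <= k)%N -> (P k).2 `<=` (P n).2.
  elim: k => [|k IH]; first by rewrite leqn0 => /eqP->.
  rewrite leq_eqVlt => /orP[/eqP->//|]; rewrite ltnS => /IH; apply: subset_trans.
  by have [oV V0] := PV k; have [_ _ _ ? _] := stP (P k) oV V0.
have small n k : (k < n)%N -> `|F (s n) (x k) - F (t n) (x k)| < n.+1%:R^-1.
  move=> kn; have [oV V0] := PV n; have [H _ _ _ _] := stP (P n) oV V0.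
  by move: (H _ (xP _ _ kn)); rewrite Psz.
have large n k : (n <= k)%N -> e / 3 < `|F (s n) (x k) - F (t n) (x k)|.
  move=> nk; have [oV V0] := PV n; have [_ _ _ _ H] := stP (P n) oV V0.
  apply: H; have [oVk V0k] := PV k; have [_ _ Hx _ _] := stP (P k) oVk V0k.
  by apply: (Vdec n.+1 k.+1 nk).
(* One ultrafilter provides the limits [y], [g], [h] at once: [g] and [h] agree at every [x k],
   hence at [y], while the tail of [x] keeps them [e / 3] apart there. *)
have [G [UG oG]] := ultraFilterLemma eventually_filter.
have [y Gy] := compact_ultra_cvg cptX (ultra_fmap x UG).
have [g cg Gg] := limF (ultra_fmap s UG).
have [h ch Gh] := limF (ultra_fmap t UG).
have Ggh z : (F (s n) z - F (t n) z) @[n --> G] --> g z - h z.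
  by apply: cvgB; [exact: Gg|exact: Gh].
have ghx k : g (x k) - h (x k) = 0.
  apply/eqP; rewrite -normr_eq0; apply/negPn/negP => nz.
  have nz0 : 0 < `|g (x k) - h (x k)| by rewrite lt_neqAle eq_sym nz normr_ge0.
  have nz20 : 0 < `|g (x k) - h (x k)| / 2 by rewrite divr_gt0.
  have /cvgrPdist_lt/(_ _ nz20) H1 := Ggh (x k).
  have H2 : \forall n \near \oo, `|F (s n) (x k) - F (t n) (x k)| <
      `|g (x k) - h (x k)| / 2.
    near=> n; apply: lt_trans (small n k _) _; first by near: n; exists k.+1.
    by near: n; exact: near_infty_natSinv_lt (PosNum nz20).
  have [n [/= n1 n2]] := filter_ex (filterI H1 (oG _ H2)).
  have := ler_distD (F (s n) (x k) - F (t n) (x k)) (g (x k) - h (x k)) 0.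
  rewrite !subr0 => /le_lt_trans /(_ (ltrD n1 n2)).
  by rewrite -splitr ltxx.
have ghy : g y - h y = 0.
  have : (g (x n) - h (x n)) @[n --> G] --> g y - h y.
    by apply: cvgB; [apply: (cvg_comp x g Gy); exact: cg|
                     apply: (cvg_comp x h Gy); exact: ch].
  under eq_fun do rewrite ghx.
  move=> H; have := cvg_unique _ H (cvg_cst 0).
  by apply.
have ygt n : e / 3 <= `|F (s n) y - F (t n) y|.
  have : `|F (s n) (x k) - F (t n) (x k)| @[k --> G] -->
      `|F (s n) y - F (t n) y|.
    apply: cvg_norm; apply: cvgB.
      by apply: (cvg_comp x (F (s n)) Gy); exact: contF.
    by apply: (cvg_comp x (F (t n)) Gy); exact: contF.
  move=> H; apply: (cvgr_to_ge H); apply: oG; exists n => // k /= nk.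
  exact/ltW/large.
have : e / 3 <= `|g y - h y|.
  have H : `|F (s n) y - F (t n) y| @[n --> G] --> `|g y - h y|.
    by apply: cvg_norm; exact: Ggh.
  by apply: (cvgr_to_ge H); apply: filterE.
by rewrite ghy normr0 leNgt e30.
Unshelve. all: by end_near. Qed.

End fragmentability.

(** * Equicontinuity *)

(** The last clause, with the triangle inequality, makes [d] continuous; distinct points may have
    distance 0. *)
Definition pseudometric_on (R : realType) (X : topologicalType)
    (d : X -> X -> R) : Prop :=
  [/\ forall x, d x x = 0, forall x y, d x y = d y x,
      forall x y z, d x z <= d x y + d y z &
      forall x e, 0 < e -> \forall y \near x, d x y < e].

Section equicontinuity.
Context (R : realType) (T : topologicalMonoidType) (X : topologicalType).
Variable S : semiflow T X.
Hypothesis cptX : compact [set: X].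
Hypothesis rightC : right_C_semigroup T.
Hypothesis minS : minimal S.
Hypothesis wapS : weakly_almost_periodic S R.

(** Compactness in [Cp] gives a limit of the translates, and evaluation at a point is continuous on
    [Cp]; this is [limF] for the translates. *)
Lemma wap_ultra_cvg (f : continuousType X R) (G : set_system T) :
  UltraFilter G ->
  exists2 g : X -> R, continuous g & forall x, f (S t x) @[t --> G] --> g x.
Proof.
move=> UG; have := wapS f; rewrite precompactE compact_ultra.
have UG' := ultra_fmap (fun t => translate S f t : Cp X R) UG.
move=> /(_ _ UG'); case.
  by apply: (@filterE _ G) => t; apply: subset_closure; exists t.
move=> g [_ Gg]; exists g; first exact: cts_fun.
move=> x.
pose ev : Cp X R -> R := fun h => (h : continuousType X R) x.
have evc : continuous ev.
  move=> h; apply: (@continuous_comp (Cp X R) {ptws X -> R} R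
    (fun h : continuousType X R => (h : {ptws X -> R})) (fun k => k x)).
    exact: initial_continuous.
  by have /pointwise_cvgP := @cvg_id _ (nbhs
    ((h : continuousType X R) : {ptws X -> R})); exact.
exact: (cvg_comp _ _ Gg (evc g)).
Qed.

(** Tube lemma: joint continuity gives a neighbourhood of [y] for each time, and compactness of [K]
    a common one. *)
Lemma act_tube (f : X -> R) (K : set T) (y : X) (e : R) :
  continuous f -> compact K -> 0 < e ->
  \forall x \near y, forall t, K t -> `|f (S t x) - f (S t y)| < e.
Proof.
move=> cf cK e0.
have := (compact_near_coveringP K).1 cK _ (nbhs y)
  (fun x t => `|f (S t x) - f (S t y)| < e) _.
apply => t Kt.
have e20 : 0 < e / 2 by rewrite divr_gt0.
have cfS : {for (t, y), continuous (fun p : T * X => f (S p.1 p.2))}.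
  apply: (@continuous_comp _ _ _ (fun p : T * X => S p.1 p.2) f).
    exact: act_jointly_continuous.
  exact: cf.
have /cvgrPdist_lt /(_ _ e20) [[A B] /= [At By] AB] := cfS.
exists (A, B) => // -[t' x] /= [At' Bx].
rewrite (le_lt_trans (ler_distD (f (S t y)) _ _))// [ltRHS]splitr ltrD//.
  by rewrite distrC; exact: (AB (t', x)).
apply: (AB (t', y)); split => //=; exact: nbhs_singleton.
Qed.

Lemma equicontinuous_orbit (f : continuousType X R) (y : X) (e : R) : 0 < e ->
  \forall x \near y, forall t, `|f (S t x) - f (S t y)| <= e.
Proof.
move=> e0.
have [U [oU U0 UE]] : exists U, [/\ open U, U !=set0 & forall t a b,
    U a -> U b -> `|f (S t a) - f (S t b)| <= e].
  apply: (@fragmented R X T (fun t x => f (S t x))) => //.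
    move=> t x; apply: (@continuous_comp _ _ _ (S t) f).
      exact: act_continuous.
    exact: cts_fun.
  exact: wap_ultra_cvg.
have [z [Usy [s _ sz]]] := minS y U0 oU; subst z.
have [K [cK TsK]] : exists K : set T, compact K /\
    ~` [set (t * s)%g | t in [set: T]] `<=` K.
  have := rightC s; rewrite precompactE => cK; exists (closure
    (~` [set (t * s)%g | t in [set: T]])); split => //.
  exact: subset_closure.
near=> x => t.
(* Minimality has provided [s] moving [y] into [U]. A time [r * s] acts by [r] on points of [U]; by
   the right C-property all other times lie in the compact set [K]. *)
have [[r _ <-]|nt] := pselect ([set (t * s)%g | t in [set: T]] t).
  rewrite !actM; apply: UE => //; near: x.
  apply: act_continuous; exact: open_nbhs_nbhs.
apply/ltW; move: (t) (TsK _ nt); near: x.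
by apply: act_tube => //; exact: cts_fun.
Unshelve. all: by end_near. Qed.

(** The uniform distance between the functions that [x] and [y] define on [T] by evaluating [f]
    along their orbits. *)
Definition orbit_dist (f : X -> R) (x y : X) : R :=
  sup [set `|f (S t x) - f (S t y)| | t in [set: T]].

Lemma orbit_dist_has_sup (f : continuousType X R) x y :
  has_sup [set `|f (S t x) - f (S t y)| | t in [set: T]].
Proof.
split; first by exists `|f (S 1%g x) - f (S 1%g y)|; exists 1%g.
have [M [_ HM]] : bounded_set (f @` [set: X]).
  apply: compact_bounded; apply: continuous_compact => //.
  by apply: continuous_subspaceT; exact: cts_fun.
exists (M + 1 + (M + 1)) => _ [t _ <-]; rewrite (le_trans (ler_normB _ _))//.
by apply: lerD; apply: HM => //; rewrite ?ltrDl//; exists (S t x) => //;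
   exists (S t y).
Qed.

Lemma orbit_dist_ub (f : continuousType X R) t x y :
  `|f (S t x) - f (S t y)| <= orbit_dist f x y.
Proof.
by apply: ub_le_sup; [case: (orbit_dist_has_sup f x y)|exists t].
Qed.

Lemma orbit_dist_le (f : continuousType X R) x y (c : R) :
  (forall t, `|f (S t x) - f (S t y)| <= c) -> orbit_dist f x y <= c.
Proof.
move=> H; apply: ge_sup; last by move=> _ [t _ <-].
by case: (orbit_dist_has_sup f x y).
Qed.

(** Equicontinuity is what makes balls neighbourhoods. *)
Lemma orbit_dist_pseudometric (f : continuousType X R) :
  pseudometric_on (orbit_dist f).
Proof.
split.
- move=> x; apply/eqP; rewrite eq_le; apply/andP; split.
    by apply: orbit_dist_le => t; rewrite subrr normr0.
  by rewrite (le_trans _ (orbit_dist_ub f 1%g x x)).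
- by move=> x y; apply/eqP; rewrite eq_le; apply/andP; split;
    apply: orbit_dist_le => t; rewrite distrC orbit_dist_ub.
- move=> x y z; apply: orbit_dist_le => t.
  by rewrite (le_trans (ler_distD (f (S t y)) _ _))// lerD// orbit_dist_ub.
- move=> x e e0; have e20 : 0 < e / 2 by rewrite divr_gt0.
  have := equicontinuous_orbit f x e20; apply: filterS => y H.
  rewrite (@le_lt_trans _ _ (e / 2))//; last by rewrite ltr_pdivrMr// ltr_pMr// ltr1n.
  by apply: orbit_dist_le => t; rewrite distrC.
Qed.

Lemma orbit_dist_nonexpansive (f : continuousType X R) t x y :
  orbit_dist f (S t x) (S t y) <= orbit_dist f x y.
Proof. by apply: orbit_dist_le => s; rewrite -!actM orbit_dist_ub. Qed.

Lemma orbit_dist_ge (f : continuousType X R) x y :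
  `|f x - f y| <= orbit_dist f x y.
Proof. by have := orbit_dist_ub f 1%g x y; rewrite !act1. Qed.

End equicontinuity.

(** * Continuous pseudometrics on a compact space *)

Section pseudometric.
Context (R : realType) (X : topologicalType) (d : X -> X -> R).
Hypothesis pmd : pseudometric_on d.

Lemma pmxx x : d x x = 0. Proof. by case: pmd. Qed.
Lemma pmC x y : d x y = d y x. Proof. by case: pmd. Qed.
Lemma pm_tri y x z : d x z <= d x y + d y z. Proof. by case: pmd. Qed.
Lemma pm_near x e : 0 < e -> \forall y \near x, d x y < e.
Proof. by case: pmd => _ _ _; apply. Qed.

Lemma pm_ge0 x y : 0 <= d x y.
Proof.
have := pm_tri y x x; rewrite pmxx (pmC y x) -mulr2n.
by rewrite pmulrn_lge0.
Qed.

Lemma pm_open_ball x e : open [set y | d x y < e].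
Proof.
rewrite openE => y /= xye; rewrite /interior /=.
have e0 : 0 < e - d x y by rewrite subr_gt0.
apply: filterS (pm_near y e0) => z yz /=.
by rewrite (le_lt_trans (pm_tri y _ _))// -ltrBrDl.
Qed.

Hypothesis cptX : compact [set: X].

(** Along [G] the points [u i] converge, and the ball of radius [e / 2] about the limit gives [A].
    This feeds [ultra_net] and [ultra_pair]. *)
Lemma pm_ultra_close (I : Type) (G : set_system I) (u : I -> X) (e : R) :
  0 < e -> UltraFilter G ->
  exists2 A, G A & forall i j, A i -> A j -> d (u i) (u j) < e.
Proof.
move=> e0 UG; have e20 : 0 < e / 2 by rewrite divr_gt0.
have [y uy] := compact_ultra_cvg cptX (ultra_fmap u UG).
exists [set i | d y (u i) < e / 2]; first exact: (uy _ (pm_near y e20)).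
move=> i j /= yi yj; rewrite (le_lt_trans (pm_tri y _ _))//.
by rewrite [ltRHS]splitr ltrD// pmC.
Qed.

Lemma pm_net (e : R) : 0 < e ->
  exists L : seq X, forall x, exists2 y, y \in L & d x y < e.
Proof.
by move=> e0; apply: ultra_net => G UG; exact: (@pm_ultra_close _ G id).
Qed.

Lemma pm_recur (u v : nat -> X) (e : R) : 0 < e ->
  exists m n, [/\ (m < n)%N, d (u m) (u n) < e & d (v m) (v n) < e].
Proof.
move=> e0.
have [m [n [mn []]]] : exists m n, (m < n)%N /\
    (d (u m) (u n) < e /\ d (v m) (v n) < e).
  apply: (@ultra_pair (fun m n => d (u m) (u n) < e /\ d (v m) (v n) < e)).
  move=> G UG; have [A GA uA] := pm_ultra_close u e0 UG.
  have [B GB vB] := pm_ultra_close v e0 UG.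
  exists (A `&` B); first exact: filterI.
  by move=> i j [Ai Bi] [Aj Bj]; split; [exact: uA|exact: vB].
by exists m, n.
Qed.

(* Backward orbits of [x] and [y] have nondecreasing mutual distance, and by
   recurrence they return close to [x] and [y]. *)
Lemma surj_nonexpansive_isometry (p : X -> X) :
  (forall y, exists x, p x = y) -> (forall x y, d (p x) (p y) <= d x y) ->
  forall x y, d (p x) (p y) = d x y.
Proof.
move=> ps pd x y; apply/eqP; rewrite eq_le pd/=.
have [q qP] := choice ps.
have pdn n a b : d (iter n p a) (iter n p b) <= d a b.
  by elim: n => //= n; exact: le_trans.
apply/ler_addgt0Pr => e e0; have e20 : 0 < e / 2 by rewrite divr_gt0.
(* A backward orbit: [b a 0] is [p a], [b a 1] is [a], and [p] lowers the index by one. *)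
pose b a n := if n is k.+1 then iter k q a else p a.
have pb a n k : iter k p (b a (n + k)%N) = b a n.
  elim: k n => [|k IH] n; first by rewrite addn0.
  rewrite iterSr addnS -(IH n); congr iter.
  by case: (n + k)%N => [//|j]; rewrite /= qP.
have bd n : d (b x 1%N) (b y 1%N) <= d (b x n.+1) (b y n.+1).
  by rewrite -(pb x 1%N n) -(pb y 1%N n) add1n.
have [m [n [mn xmn ymn]]] := pm_recur (b x) (b y) e20.
(* Applying [p] [m] times moves the return from indices [m], [n] to indices 0, [n - m]. *)
have xmn' : d (p x) (b x (n - m)%N) < e / 2.
  rewrite -[p x]/(b x 0%N) -(pb x 0%N m) -(pb x (n - m)%N m).
  by rewrite add0n subnK; [exact: le_lt_trans xmn|exact: ltnW].
have ymn' : d (p y) (b y (n - m)%N) < e / 2.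
  rewrite -[p y]/(b y 0%N) -(pb y 0%N m) -(pb y (n - m)%N m).
  by rewrite add0n subnK; [exact: le_lt_trans ymn|exact: ltnW].
have := bd (n - m).-1; rewrite prednK ?subn_gt0//= => /le_trans; apply.
rewrite (le_trans (pm_tri (p x) _ _))// (le_trans (lerD (lexx _) (pm_tri (p y) _ _)))//.
rewrite (pmC _ (p x)); lra.
Qed.

End pseudometric.

Lemma urysohn_function (R : realType) (X : topologicalType) (A B : set X) :
  compact [set: X] -> hausdorff_space X ->
  closed A -> closed B -> A `&` B = set0 ->
  exists f : X -> R, [/\ continuous f, forall x, 0 <= f x <= 1,
    forall x, A x -> f x = 0 & forall x, B x -> f x = 1].
Proof.
move=> cX hX cA cB AB.
have := (@normal_separatorP R X).1 (compact_normal hX cX) _ _ cA cB AB.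
move=> /(@uniform_separatorP X R)[f [cf f01 f0 f1]].
exists f; split => // x.
- by have := f01 (f x); rewrite /= in_itv/=; apply; exists x.
- by move=> Ax; apply: f0; exists x.
- by move=> Bx; apply: f1; exists x.
Qed.

(** * The group of isometries *)

(* By Urysohn's lemma, the last clause says that [D] induces the topology. *)
Definition separating_family (R : realType) (X : topologicalType)
    (D : set (X -> X -> R)) : Prop :=
  [/\ forall d, D d -> pseudometric_on d,
      forall d1 d2, D d1 -> D d2 -> D (fun x y => d1 x y + d2 x y) &
      forall f : X -> R, continuous f ->
        exists2 d, D d & forall x y, `|f x - f y| <= d x y].

(** Continuity and bijectivity follow when [D] induces the topology of a compact Hausdorff space. *)
Definition isometry_for (R : realType) (X : Type) (D : set (X -> X -> R))
    (p : X -> X) : Prop :=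
  forall d, D d -> forall x y, d (p x) (p y) = d x y.

Section isometries.
Context (R : realType) (X : topologicalType) (D : set (X -> X -> R)).
Hypothesis cptX : compact [set: X].
Hypothesis hausX : hausdorff_space X.
Hypothesis famD : separating_family D.

Notation isom := (isometry_for D).

Let pmD d : D d -> pseudometric_on d.
Proof. by case: famD => + _ _; apply. Qed.

Lemma closed_point (x : X) : closed [set x].
Proof.
exact: (@accessible_closed_set1 _ (hausdorff_accessible hausX)).
Qed.

(** A Urysohn function jumps by 1 between [x] and the complement of [U], and some [d] dominates its
    variation; hence radius 1 always suffices. *)
Lemma family_nbhs (U : set X) x : open U -> U x ->
  exists2 d, D d & forall y, d x y < 1 -> U y.
Proof.
move=> oU Ux.
have [|f [cf _ f0 f1]] := @urysohn_function R X [set x] (~` U) cptX hausX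
  (@closed_point x) (open_closedC oU).
  by apply/seteqP; split => // y [->].
have [_ _ /(_ f cf)[d Dd df]] := famD.
exists d => // y xy1; apply: contrapT => nUy.
have := le_lt_trans (df x y) xy1.
by rewrite f0// f1// sub0r normrN normr1 ltxx.
Qed.

Lemma family_nonempty : D !=set0.
Proof.
have [_ _ /(_ (fun=> 0))[|d Dd _]] := famD; last by exists d.
by move=> x; exact: cvg_cst.
Qed.

Lemma isom_comp p q : isom p -> isom q -> isom (p \o q).
Proof. by move=> ip iq d Dd x y /=; rewrite ip// iq. Qed.

Lemma isom_iter p n : isom p -> isom (iter n p).
Proof. by move=> ip; elim: n => //= n IH; exact: (isom_comp ip IH). Qed.

Lemma isom_continuous p : isom p -> continuous p.
Proof.
move=> ip x A /=; rewrite nbhsE => -[U [oU Ux] UA].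
have [d Dd dU] := family_nbhs oU Ux.
apply: filterS (pm_near (pmD Dd) x (ltr01)) => y xy1.
by apply/UA/dU; rewrite ip.
Qed.

Lemma isom_inj p : isom p -> injective p.
Proof.
move=> ip x y pxy; apply: hausX => A B.
rewrite !nbhsE => -[U [oU Ux] UA] [V [oV Vy] VB].
have [d Dd dU] := family_nbhs oU Ux.
exists y; split; last exact: VB.
by apply/UA/dU; rewrite -ip// pxy pmxx//; exact: pmD.
Qed.

(** If the compact image missed [y], it would miss a unit ball about [y] for some [d] in [D]; yet by
    recurrence some positive iterate of [p] brings [y] back into this ball. *)
Lemma isom_surj p : isom p -> forall y, exists x, p x = y.
Proof.
move=> ip y; apply: contrapT => ny.
have cp : closed (p @` [set: X]).
  apply: compact_closed => //; apply: continuous_compact => //.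
  exact/continuous_subspaceT/isom_continuous.
have [||d Dd dp] := @family_nbhs (~` (p @` [set: X])) y.
- exact: closed_openC.
- by move=> [x _ pxy]; apply: ny; exists x.
have [m [n [mn dmn _]]] :=
  pm_recur (pmD Dd) cptX (fun k => iter k p y) (fun k => iter k p y) (@ltr01 R).
apply: (dp (iter (n - m) p y)).
  rewrite -[iter (n - m) _ _]/(id _) -(isom_iter m ip Dd) -iterD addnC subnK//.
  exact: ltnW.
exists (iter (n - m).-1 p y) => //.
by rewrite -iterS prednK// subn_gt0.
Qed.

Lemma isom_inverse p : isom p ->
  exists q, [/\ isom q, cancel p q & cancel q p].
Proof.
move=> ip; have [q qP] := choice (isom_surj ip).
exists q; split => // [d Dd x y|x]; first by rewrite -(ip d Dd) !qP.
by apply: (isom_inj ip); rewrite qP.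
Qed.

Lemma pm_cvg_eq (d : X -> X -> R) (I : Type) (G : set_system I)
    (u v : I -> X) (x y : X) (c : R) :
  D d -> ProperFilter G -> u @ G --> x -> v @ G --> y ->
  (forall i, d (u i) (v i) = c) -> d x y = c.
Proof.
move=> Dd PG ux vy uv; have dpm := pmD Dd.
apply/eqP; rewrite -subr_eq0 -normr_eq0; apply/negPn/negP => nz.
have e0 : 0 < `|d x y - c| / 2.
  by rewrite divr_gt0// lt_neqAle eq_sym nz normr_ge0.
have Gx : G [set i | d x (u i) < `|d x y - c| / 2] := ux _ (pm_near dpm x e0).
have Gy : G [set i | d y (v i) < `|d x y - c| / 2] := vy _ (pm_near dpm y e0).
have [i [/= xi yi]] := filter_ex (filterI Gx Gy).
have : `|d x y - c| <= d x (u i) + d y (v i).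
  rewrite -(uv i) ler_norml; apply/andP; split.
    have := pm_tri dpm x (u i) (v i); have := pm_tri dpm y x (v i).
    by rewrite (pmC dpm (u i) x) => *; lra.
  have := pm_tri dpm (u i) x y; have := pm_tri dpm (v i) (u i) y.
  by rewrite (pmC dpm (v i) y) => *; lra.
by move=> /le_lt_trans/(_ (ltrD xi yi)); rewrite -splitr ltxx.
Qed.

(** Compactness of the isometry group, without a topology on it: limits exist pointwise in [X], and
    distances pass to the limit. *)
Lemma isom_ultra_limit (I : Type) (G : set_system I) (p : I -> X -> X) :
  UltraFilter G -> (forall i, isom (p i)) ->
  exists2 q, isom q & forall x, p i x @[i --> G] --> q x.
Proof.
move=> UG ip.
have [q qP] := choice (fun x => compact_ultra_cvg cptX (ultra_fmap (p^~ x) UG)).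
exists q => // d Dd x y; apply: (pm_cvg_eq Dd _ (qP x) (qP y)) => i.
exact: ip.
Qed.

End isometries.

Definition homogeneous_for (R : realType) (X : Type) (D : set (X -> X -> R)) :=
  forall x y, exists2 p, isometry_for D p & p x = y.

(** * Invariant pseudometrics and the transitivity of their isometries *)

Section invariant_pseudometrics.
Context (R : realType) (T : topologicalMonoidType) (X : topologicalType).
Variable S : semiflow T X.
Hypothesis cptX : compact [set: X].
Hypothesis hausX : hausdorff_space X.
Hypothesis rightC : right_C_semigroup T.
Hypothesis minS : minimal S.
Hypothesis wapS : weakly_almost_periodic S R.
Hypothesis surjS : forall t : T, set_surj [set: X] [set: X] (S t).

Definition invariant_pseudometrics : set (X -> X -> R) :=
  [set d | pseudometric_on d /\ forall t x y, d (S t x) (S t y) = d x y].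

(** The pseudometric [orbit_dist S f] dominates the variation of [f]; surjectivity upgrades its
    nonexpansiveness to invariance. *)
Lemma invariant_pseudometrics_separating :
  separating_family invariant_pseudometrics.
Proof.
split.
- by move=> d [].
- move=> d1 d2 [pm1 i1] [pm2 i2]; split; last by move=> t x y; rewrite i1 i2.
  split.
  + by move=> x; rewrite (pmxx pm1) (pmxx pm2) addr0.
  + by move=> x y; rewrite (pmC pm1) (pmC pm2).
  + by move=> x y z; rewrite addrACA lerD// pm_tri.
  + move=> x e e0; have e20 : 0 < e / 2 by rewrite divr_gt0.
    apply: filterS (filterI (pm_near pm1 x e20) (pm_near pm2 x e20)) => y [].
    by move=> /= d1y d2y; rewrite [ltRHS]splitr ltrD.
- move=> f cf.
  pose f' : continuousType X R := HB.pack f (isContinuous.Build X R f cf).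
  have pmf := orbit_dist_pseudometric cptX rightC minS wapS f'.
  exists (orbit_dist S f'); last exact: (orbit_dist_ge S cptX f').
  split => // t; apply: (surj_nonexpansive_isometry pmf cptX).
    by move=> y; have [x _ <-] := @surjS t y I; exists x.
  exact: orbit_dist_nonexpansive.
Qed.

Lemma act_isometry t : isometry_for invariant_pseudometrics (S t).
Proof. by move=> d [_ iS]; exact: iS. Qed.

(** By minimality the orbit of [x] accumulates at [y]; a limit of the [S t] along an ultrafilter
    with [S t x] tending to [y] is the isometry. *)
Lemma invariant_pseudometrics_homogeneous :
  homogeneous_for invariant_pseudometrics.
Proof.
move=> x y.
pose F := filter_from (nbhs y) (fun U => [set t | U (S t x)]).
have PF : ProperFilter F.
  apply: filter_from_proper => [|U Uy]; last first.
    have [z [Uz [t _ tz]]] := minS x (ex_intro _ y (nbhs_singleton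
      (nbhs_interior Uy))) (@open_interior _ U).
    by exists t; rewrite /= tz; exact: interior_subset.
  apply: filter_from_filter; first by exists setT; exact: filterT.
  by move=> U V Uy Vy; exists (U `&` V); first exact: filterI.
have [G [UG FG]] := ultraFilterLemma PF.
have [p ip Gp] := isom_ultra_limit cptX invariant_pseudometrics_separating
  UG act_isometry.
exists p => //; apply: (cvg_unique hausX (Gp x)) => U Uy.
by apply: FG; exists U.
Qed.

End invariant_pseudometrics.

(** * Covering numbers and the invariant content *)

Section covering_numbers.
Context (R : realType) (X : topologicalType).
Implicit Types (d : X -> X -> R) (K L : set X) (s : seq X).

(** The radius is fixed at 1; refinement comes from enlarging [d] within a family closed under
    sums. *)
Definition ball_cover d K s := forall x, K x -> exists2 y, y \in s & d x y < 1.

Definition ball_cover_size d K : pred nat :=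
  fun n => `[< exists2 s, size s = n & ball_cover d K s >].

(* Equal to 0 when no finite cover exists. *)
Definition covering_number d K : nat :=
  if pselect (exists n, ball_cover_size d K n) is left e then ex_minn e else 0%N.

Lemma covering_number_le d K s :
  ball_cover d K s -> (covering_number d K <= size s)%N.
Proof.
move=> cs; rewrite /covering_number; case: pselect => // e.
by case: ex_minnP => m _; apply; apply/asboolP; exists s.
Qed.

Hypothesis cptX : compact [set: X].

Lemma covering_number_ex d K : pseudometric_on d ->
  exists2 s, size s = covering_number d K & ball_cover d K s.
Proof.
move=> pmd; rewrite /covering_number; case: pselect => [e|ne].
  by case: ex_minnP => m /asboolP[s sm cs] _; exists s.
exfalso; apply: ne; have [s sP] := pm_net pmd cptX (@ltr01 R).
by exists (size s); apply/asboolP; exists s.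
Qed.

Lemma le_covering_number d K L : pseudometric_on d -> K `<=` L ->
  (covering_number d K <= covering_number d L)%N.
Proof.
move=> pmd KL; have [s <- sL] := covering_number_ex L pmd.
by apply: covering_number_le => x /KL/sL.
Qed.

Lemma covering_numberU d K L : pseudometric_on d ->
  (covering_number d (K `|` L) <= covering_number d K + covering_number d L)%N.
Proof.
move=> pmd; have [s <- sK] := covering_number_ex K pmd.
have [t <- tL] := covering_number_ex L pmd; rewrite -size_cat.
apply: covering_number_le => x [/sK|/tL] [y ys xy]; exists y => //;
by rewrite mem_cat ys ?orbT.
Qed.

(** No unit ball meets both sets, so a cover of the union splits into disjoint parts covering [K]
    and [L]. *)
Lemma covering_numberU_separated d K L : pseudometric_on d ->
  (forall x y, K x -> L y -> 2 <= d x y) ->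
  (covering_number d K + covering_number d L <= covering_number d (K `|` L))%N.
Proof.
move=> pmd KL; have [s <- sKL] := covering_number_ex (K `|` L) pmd.
pose P y := `[< exists2 x, K x & d x y < 1 >].
rewrite -(count_predC P) -!size_filter leq_add//; apply: covering_number_le.
  move=> x Kx; have [|y ys xy] := sKL x; first by left.
  by exists y => //; rewrite mem_filter ys andbT; apply/asboolP; exists x.
move=> x Lx; have [|y ys xy] := sKL x; first by right.
exists y => //; rewrite mem_filter ys andbT /=; apply/negP => /asboolP[z Kz zy].
have := KL _ _ Kz Lx; have := pm_tri pmd y z x; rewrite (pmC pmd y x); lra.
Qed.

Lemma covering_number_isom d K p q : pseudometric_on d ->
  (forall x y, d (p x) (p y) = d x y) -> cancel p q -> cancel q p ->
  covering_number d (p @` K) = covering_number d K.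
Proof.
move=> pmd ip pq qp; apply/eqP; rewrite eqn_leq; apply/andP; split.
  have [s <- sK] := covering_number_ex K pmd; rewrite -(size_map p).
  apply: covering_number_le => _ [x /sK[y ys xy] <-].
  by exists (p y); [exact: map_f|rewrite ip].
have [s <- sK] := covering_number_ex (p @` K) pmd; rewrite -(size_map q).
apply: covering_number_le => x Kx.
have [|y ys xy] := sK (p x); first by exists x.
by exists (q y); [exact: map_f|rewrite -ip qp].
Qed.

Lemma covering_number_gt0 d K x : pseudometric_on d -> K x ->
  (0 < covering_number d K)%N.
Proof.
move=> pmd Kx; have [s <- sK] := covering_number_ex K pmd.
by have [y] := sK x Kx; case: s {sK}.
Qed.

End covering_numbers.

(** Covering numbers make sense for all sets, so [h] is total; additivity is asked for disjoint
    closed sets, which Urysohn functions separate. *)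
Record is_content (R : realType) (X : topologicalType) (h : set X -> R)
    : Prop := IsContent {
  content_ge0 : forall K, 0 <= h K ;
  content_setT : h [set: X] = 1 ;
  le_content : forall K L, K `<=` L -> h K <= h L ;
  contentU_le : forall K L, h (K `|` L) <= h K + h L ;
  contentU : forall K L, closed K -> closed L -> K `&` L = set0 ->
    h (K `|` L) = h K + h L }.

(* Haar's construction: a limit of ratios of covering numbers. *)
Lemma invariant_content_exists (R : realType) (X : topologicalType)
    (D : set (X -> X -> R)) (x0 : X) :
  compact [set: X] -> hausdorff_space X -> separating_family D ->
  exists2 h : set X -> R, is_content h &
    forall p K, isometry_for D p -> h (p @` K) = h K.
Proof.
move=> cX hX famD; have [pmD DD Dsep] := famD.
(* Large pseudometrics play the role of small neighbourhoods of the identity in Haar's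
   construction. *)
pose up d : set (X -> X -> R) := [set d' | D d' /\ forall x y, d x y <= d' x y].
have PF : ProperFilter (filter_from D up).
  apply: filter_from_proper => [|d Dd]; last by exists d.
  apply: filter_from_filter; first exact: (family_nonempty famD).
  move=> d1 d2 D1 D2; exists (fun x y => d1 x y + d2 x y); first exact: DD.
  move=> d [Dd dle]; split; split => // x y; apply: le_trans (dle x y).
    by rewrite lerDl pm_ge0//; exact: pmD.
  by rewrite lerDr pm_ge0//; exact: pmD.
have [G [UG FG]] := ultraFilterLemma PF.
have GD : G D by apply: FG; have [d Dd] := family_nonempty famD; exists d => // d' [].
pose rat (K : set X) (d : X -> X -> R) : R :=
  (covering_number d K)%:R / (covering_number d setT)%:R.
have rat_ge0 K d : 0 <= rat K d by rewrite divr_ge0.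
have ratT d : D d -> rat setT d = 1.
  move=> Dd; rewrite /rat divff// pnatr_eq0 -lt0n.
  by apply: (@covering_number_gt0 _ _ cX d setT x0) => //; exact: pmD.
have rat_homo K L d : D d -> K `<=` L -> rat K d <= rat L d.
  move=> Dd KL; rewrite ler_wpM2r// ler_nat le_covering_number//; exact: pmD.
have rat_le1 K d : D d -> rat K d <= 1.
  by move=> Dd; rewrite -(ratT d Dd) rat_homo.
(* The ratios stay in the compact interval from 0 to 1, so one ultrafilter makes all of them
   converge. *)
have hex K : exists c : R, rat K d @[d --> G] --> c.
  have := @segment_compact R 0 1; rewrite compact_ultra.
  move=> /(_ _ (ultra_fmap (rat K) UG)) [|c [_ Gc]]; last by exists c.
  by apply: (@filterS _ G _ _ _ _ GD) => d Dd /=; rewrite in_itv/= rat_ge0 rat_le1.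
have [h hP] := choice hex.
exists h; first split.
- by move=> K; apply: (cvgr_to_ge (hP K)); exact: filterE.
- apply: (cvg_unique _ (hP setT)) => //; apply: (@cvg_trans _ ((fun=> 1) @ G)).
    by apply: near_eq_cvg; apply: filterS GD => d Dd; rewrite ratT.
  exact: cvg_cst.
- move=> K L KL; rewrite -subr_ge0; apply: (cvgr_to_ge (cvgB (hP L) (hP K))).
  by apply: filterS GD => d Dd /=; rewrite subr_ge0 rat_homo.
- move=> K L; rewrite -subr_ge0.
  apply: (cvgr_to_ge (cvgB (cvgD (hP K) (hP L)) (hP (K `|` L)))).
  apply: filterS GD => d Dd; rewrite /= subr_ge0.
  rewrite -[leRHS]/(rat K d + rat L d) /rat -mulrDl -natrD ler_wpM2r//.
  by rewrite ler_nat covering_numberU//; exact: pmD.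
- move=> K L cK cL KL.
  have [f [cf f01 f0 f1]] := @urysohn_function R X K L cX hX cK cL KL.
  (* The factor 2 puts [K] and [L] at distance at least 2 for all pseudometrics above [d], where
     covering numbers are exactly additive. *)
  have [|d Dd df] := Dsep (fun x => f x * 2).
    by move=> x; apply: cvgMl; exact: cf.
  have GdL : G [set d' | rat K d' + rat L d' = rat (K `|` L) d'].
    apply: FG; exists d => // d' [Dd' dd'] /=; rewrite /rat -mulrDl; congr (_ / _).
    rewrite -natrD; congr _%:R; apply/eqP; rewrite eqn_leq; apply/andP; split.
      apply: covering_numberU_separated => //; first exact: pmD.
      move=> x y Kx Ly; apply: le_trans (dd' _ _); apply: le_trans (df _ _).
      by rewrite f0// f1// mul0r mul1r sub0r normrN ger0_norm.
    by apply: covering_numberU => //; exact: pmD.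
  apply: (cvg_unique _ (hP (K `|` L))) => //.
  apply: cvg_trans (cvgD (hP K) (hP L)); apply: near_eq_cvg.
  exact: GdL.
move=> p K ip; have [q [iq pq qp]] := isom_inverse cX hX famD ip.
apply: (cvg_unique _ (hP (p @` K))) => //.
apply: cvg_trans (hP K); apply: near_eq_cvg; apply: filterS GD => d Dd.
rewrite /rat (@covering_number_isom _ _ cX d K p q)//; first exact: pmD.
exact: ip.
Qed.

(** * The regular measure of a content *)

Section regular_measure.
Context (R : realType) (X : ptopologicalType).
Variable h : set X -> R.
Hypothesis cptX : compact [set: X].
Hypothesis hausX : hausdorff_space X.
Hypothesis hC : is_content h.

(** The classical extension of a content: closed sets approximate open sets from inside, then open
    sets approximate all sets from outside. *)
Definition inner_content (U : set X) : R :=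
  sup [set h K | K in [set K | closed K /\ K `<=` U]].

Definition outer_content (A : set X) : R :=
  inf [set inner_content U | U in [set U | open U /\ A `<=` U]].

Lemma content_le1 K : h K <= 1.
Proof. by rewrite -(content_setT hC); exact: le_content. Qed.

Lemma content_set0 : h set0 = 0.
Proof.
have := contentU hC (@closed0 X) (@closed0 X) (setI0 _); rewrite setU0 => h0.
by apply: (addrI (h set0)); rewrite addr0 -h0.
Qed.

Lemma inner_has_sup U :
  has_sup [set h K | K in [set K | closed K /\ K `<=` U]].
Proof.
split; first by exists (h set0); exists set0 => //; split => //; exact: closed0.
by exists 1 => _ [K _ <-]; exact: content_le1.
Qed.

Lemma content_le_inner U K : closed K -> K `<=` U -> h K <= inner_content U.
Proof.
by move=> cK KU; apply: ub_le_sup; [case: (inner_has_sup U)|exists K].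
Qed.

Lemma inner_le U c : (forall K, closed K -> K `<=` U -> h K <= c) ->
  inner_content U <= c.
Proof.
move=> H; apply: ge_sup; first by case: (inner_has_sup U).
by move=> _ [K [cK KU] <-]; exact: H.
Qed.

Lemma inner_adherent U e : 0 < e ->
  exists K, [/\ closed K, K `<=` U & inner_content U - e < h K].
Proof.
move=> e0; have [_ [K [cK KU] <-] hK] := sup_adherent e0 (inner_has_sup U).
by exists K.
Qed.

Lemma inner_ge0 U : 0 <= inner_content U.
Proof. by rewrite -content_set0; apply: content_le_inner => //; exact: closed0. Qed.

Lemma inner_homo U V : U `<=` V -> inner_content U <= inner_content V.
Proof.
move=> UV; apply: inner_le => K cK KU; apply: content_le_inner => //.
exact: subset_trans UV.
Qed.

Lemma outer_has_inf A :
  has_inf [set inner_content U | U in [set U | open U /\ A `<=` U]].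
Proof.
split; first by exists (inner_content setT); exists setT => //; split => //; exact: openT.
by exists 0 => _ [U _ <-]; exact: inner_ge0.
Qed.

Lemma outer_le_inner A U : open U -> A `<=` U -> outer_content A <= inner_content U.
Proof.
by move=> oU AU; apply: ge_inf; [case: (outer_has_inf A)|exists U].
Qed.

Lemma le_outer A c : (forall U, open U -> A `<=` U -> c <= inner_content U) ->
  c <= outer_content A.
Proof.
move=> H; apply: lb_le_inf; first by case: (outer_has_inf A).
by move=> _ [K [cK KU] <-]; exact: H.
Qed.

Lemma outer_adherent A e : 0 < e ->
  exists U, [/\ open U, A `<=` U & inner_content U < outer_content A + e].
Proof.
move=> e0; have [_ [U [oU AU] <-] hU] := inf_adherent e0 (outer_has_inf A).
by exists U.
Qed.

Lemma outer_ge0 A : 0 <= outer_content A.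
Proof. by apply: le_outer => U _ _; exact: inner_ge0. Qed.

Lemma outer_homo A B : A `<=` B -> outer_content A <= outer_content B.
Proof.
move=> AB; apply: le_outer => U oU BU; apply: outer_le_inner => //.
exact: subset_trans BU.
Qed.

Lemma outer_open U : open U -> outer_content U = inner_content U.
Proof.
move=> oU; apply/eqP; rewrite eq_le outer_le_inner//=.
by apply: le_outer => V _; exact: inner_homo.
Qed.

Lemma content_le_outer K : closed K -> h K <= outer_content K.
Proof. by move=> cK; apply: le_outer => U oU KU; exact: content_le_inner. Qed.

Lemma outer_set0 : outer_content set0 = 0.
Proof.
apply/eqP; rewrite eq_le outer_ge0 andbT outer_open; last exact: open0.
by apply: inner_le => K _; rewrite subset0 => ->; rewrite content_set0.
Qed.

Lemma outer_setT : outer_content setT = 1.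
Proof.
rewrite outer_open; last exact: openT.
apply/eqP; rewrite eq_le -(content_setT hC); apply/andP; split.
  by apply: inner_le => K _ _; exact: le_content.
by apply: content_le_inner => //; exact: closedT.
Qed.

(** Disjoint open sets [P] and [Q] around [K] minus [U] and [K] minus [V] cut [K] into a closed part
    in [U] and a closed part in [V]. *)
Lemma inner_setU U V : open U -> open V ->
  inner_content (U `|` V) <= inner_content U + inner_content V.
Proof.
move=> oU oV; apply: inner_le => K cK KUV.
have [|P [Q [oP oQ KP KQ PQ]]] := (@normal_openP R X).1 (compact_normal hausX cptX)
    (K `&` ~` U) (K `&` ~` V) (closedI cK (open_closedC oU))
    (closedI cK (open_closedC oV)).
  by apply/seteqP; split => // x [[Kx nU] [_ nV]]; case: (KUV x Kx).
have -> : K = (K `&` ~` P) `|` (K `&` ~` Q).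
  apply/seteqP; split => [x Kx|x [[]|[]]//].
  have [Px|nPx] := pselect (P x); [right|left] => //; split => // Qx.
  by have : (P `&` Q) x by []; rewrite PQ.
rewrite (le_trans (contentU_le hC _ _))// lerD// content_le_inner//.
- by apply: closedI => //; exact: open_closedC.
- by move=> x [Kx nPx]; apply: contrapT => nU; apply: nPx; exact: KP.
- by apply: closedI => //; exact: open_closedC.
- by move=> x [Kx nQx]; apply: contrapT => nV; apply: nQx; exact: KQ.
Qed.

Lemma inner_bigsetU (U : (set X)^nat) n : (forall i, open (U i)) ->
  inner_content (\bigcup_(i < n) U i) <= \sum_(i < n) inner_content (U i).
Proof.
move=> oU; elim: n => [|n IH].
  by rewrite big_ord0 bigcup_mkord big_ord0 -outer_open ?outer_set0//; exact: open0.
rewrite big_ord_recr /= bigcup_mkord big_ord_recr /= -bigcup_mkord.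
apply: (le_trans (inner_setU _ (oU n))); first by apply: bigcup_open => i _.
by rewrite lerD2r.
Qed.

Lemma inner_bigcup (U : (set X)^nat) (K : set X) : (forall i, open (U i)) ->
  closed K -> K `<=` \bigcup_n U n ->
  exists n, h K <= \sum_(i < n) inner_content (U i).
Proof.
move=> oU cK KU.
have cptK : compact K by exact: subclosed_compact cK cptX _.
have [|n _ Kn] := (compact_near_coveringP K).1 cptK _ \oo
    (fun n x => (\bigcup_(i < n) U i) x) _.
  move=> x /KU[i _ Ux]; exists (U i, [set n | (i < n)%N]) => /=.
    by split; [exact: open_nbhs_nbhs|exists i.+1].
  by move=> [y n] [/= Uy iltn]; exists i.
exists n; rewrite (le_trans _ (inner_bigsetU n oU))//.
by apply: content_le_inner => //; exact: (Kn n (leqnn n)).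
Qed.

Local Open Scope ereal_scope.

Lemma outer_sigma_subadditive :
  sigma_subadditive (fun A => (outer_content A)%:E).
Proof.
move=> F; apply/lee_addgt0Pr => e e0.
have ei0 i : (0 < e / (2 ^ i.+1)%:R)%R by rewrite divr_gt0// ltr0n expn_gt0.
have [U UP] := choice (fun i => outer_adherent (F i) (ei0 i)).
have oU i : open (U i) by case: (UP i).
apply: (le_trans _ (epsilon_trick xpredT _ (ltW e0))); last first.
  by move=> n; rewrite lee_fin outer_ge0.
apply: (@le_trans _ _ (\sum_(i <oo) (inner_content (U i))%:E)); last first.
  apply: lee_nneseries => i _ //; first by rewrite lee_fin inner_ge0.
  by rewrite -EFinD lee_fin ltW//; case: (UP i).
apply: (@le_trans _ _ (inner_content (\bigcup_n U n))%:E).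
  rewrite lee_fin outer_le_inner//; first exact: bigcup_open.
  by apply: subset_bigcup => i _; case: (UP i).
suff H K : closed K -> K `<=` \bigcup_n U n ->
    (h K)%:E <= \sum_(i <oo) (inner_content (U i))%:E.
  have s0 : 0 <= \sum_(i <oo) (inner_content (U i))%:E.
    by apply: nneseries_ge0 => i _ _; rewrite lee_fin inner_ge0.
  move: H s0; case: (\sum_(i <oo) _) => [r H _| _ _|//]; last by rewrite leey.
  by rewrite lee_fin; apply: inner_le => K cK KU; rewrite -lee_fin H.
move=> cK KU; have [n Kn] := inner_bigcup oU cK KU.
have := @nneseries_lim_ge R (fun i => (inner_content (U i))%:E) xpredT 0 n.
rewrite big_mkord sumEFin => H; apply: le_trans (H _); first by rewrite lee_fin.
by move=> i _ _; rewrite lee_fin inner_ge0.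
Qed.

Let mu (A : set X) : \bar R := (outer_content A)%:E.

Let mu0 : mu set0 = 0. Proof. by rewrite /mu outer_set0. Qed.
Let mu_ge0 A : 0 <= mu A. Proof. by rewrite lee_fin outer_ge0. Qed.
Let mu_homo : {homo mu : A B / A `<=` B >-> A <= B}.
Proof. by move=> A B AB; rewrite lee_fin outer_homo. Qed.

HB.instance Definition _ :=
  isOuterMeasure.Build R X mu mu0 mu_ge0 mu_homo outer_sigma_subadditive.

(** From an open [O] around [A], remove a closed [K] nearly exhausting the intersection of [O] and
    [U]; closed sets in the rest are disjoint from [K], so additivity of [h] applies. *)
Lemma open_caratheodory U : open U -> caratheodory_measurable mu U.
Proof.
move=> oU; apply: le_caratheodory_measurable => A; rewrite -EFinD lee_fin.
apply: le_outer => O oO AO; apply/ler_addgt0Pr => e e0.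
have [K [cK KU hK]] := inner_adherent (O `&` U) e0.
have oOK : open (O `&` ~` K) by apply: openI => //; exact: closed_openC.
have AU : (outer_content (A `&` U) <= inner_content (O `&` U))%R.
  by apply: outer_le_inner; [exact: openI|exact: setSI].
have AnU : (outer_content (A `&` ~` U) <= inner_content (O `&` ~` K))%R.
  by apply: outer_le_inner => // x [/AO Ox nUx]; split => // /KU[].
suff : (inner_content (O `&` ~` K) <= inner_content O - h K)%R by lra.
apply: inner_le => L cL LO; rewrite lerBrDr -contentU//; last first.
  by apply/seteqP; split => // x [/LO[_ nK]].
by apply: content_le_inner; [exact: closedU|move=> x [/LO[]|/KU[]]].
Qed.

Let borel_caratheodory (A : set (borel X)) :
  measurable A -> caratheodory_measurable mu A.
Proof.
move=> mA; apply: (smallest_sub _ _ mA); last exact: open_caratheodory.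
exact: (@sigma_algebra_measurable _ (caratheodory_type mu)).
Qed.

(** The same function on the type carrying the Borel sigma-algebra, so that measure structures
    attach to it. *)
Let nu : set (borel X) -> \bar R := mu.

Let nu_sigma_additive : semi_sigma_additive nu.
Proof.
move=> F mF tF mUF.
apply: (@caratheodory_measure_sigma_additive R X mu F) => //.
- by move=> i; exact: borel_caratheodory.
- exact: borel_caratheodory.
Qed.

HB.instance Definition _ := isMeasure.Build _ (borel X) R nu
  mu0 mu_ge0 nu_sigma_additive.

Let nuT : nu setT = 1. Proof. by rewrite /nu /mu outer_setT. Qed.

HB.instance Definition _ := Measure_isProbability.Build _ (borel X) R nu nuT.

Lemma outer_content_probability :
  exists m : probability (borel X) R, forall A, m A = (outer_content A)%:E.
Proof. by exists nu. Qed.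

End regular_measure.

(** * Invariance of the regular measure under isometries *)

Section invariant_measure.
Context (R : realType) (X : ptopologicalType) (D : set (X -> X -> R)).
Hypothesis cptX : compact [set: X].
Hypothesis hausX : hausdorff_space X.
Hypothesis famD : separating_family D.

Lemma isom_image_closed p K : isometry_for D p -> closed K -> closed (p @` K).
Proof.
move=> ip cK; apply: compact_closed => //; apply: continuous_compact.
  exact/continuous_subspaceT/(isom_continuous cptX hausX famD ip).
exact: subclosed_compact cK cptX _.
Qed.

Lemma isom_image_open p U : isometry_for D p -> open U -> open (p @` U).
Proof.
move=> ip oU; have [q [iq pq qp]] := isom_inverse cptX hausX famD ip.
have -> : p @` U = q @^-1` U.
  apply/seteqP; split => [_ [x Ux <-]|x qUx]; first by rewrite /= pq.
  by exists (q x).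
apply: open_comp => // x _; exact: (isom_continuous cptX hausX famD iq).
Qed.

(** One inequality for every isometry suffices, as it also applies to the inverse. *)
Lemma isom_outer_content (h : set X -> R) p A : is_content h ->
  (forall p K, isometry_for D p -> h (p @` K) = h K) ->
  isometry_for D p -> outer_content h (p @` A) = outer_content h A.
Proof.
move=> hC hD ip.
have le_oc p1 A1 : isometry_for D p1 ->
    outer_content h (p1 @` A1) <= outer_content h A1.
  move=> ip1; have [q [iq pq qp]] := isom_inverse cptX hausX famD ip1.
  apply: le_outer => // U oU AU; apply: (@le_trans _ _ (inner_content h (p1 @` U))).
    by apply: outer_le_inner => //; [exact: isom_image_open|exact: image_subset].
  apply: inner_le => // K cK KU; rewrite -(hD q)//.
  apply: content_le_inner => //; first exact: isom_image_closed.
  by move=> _ [x /KU[y Uy <-] <-]; rewrite pq.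
apply/eqP; rewrite eq_le le_oc//=.
have [q [iq pq qp]] := isom_inverse cptX hausX famD ip.
have {1}-> : A = q @` (p @` A); last exact: le_oc.
apply/seteqP; split => [x Ax|_ [_ [x Ax <-] <-]]; last by rewrite pq.
by exists (p x) => //; exists x.
Qed.

(** Invariance is available for arbitrary [A] because [mu] has the values of an outer measure on all
    sets. *)
Lemma invariant_regular_probability :
  exists mu : probability (borel X) R,
    (forall p A, isometry_for D p -> mu (p @` A) = mu A) /\
    (forall U e, open U -> 0 < e -> exists K, [/\ closed K, K `<=` U &
       (mu U <= mu K + e%:E)%E]).
Proof.
have [h hC hD] := invariant_content_exists (@point X) cptX hausX famD.
have [mu muE] := outer_content_probability cptX hausX hC.
exists mu; split => [p A ip|U e oU e0].
  by rewrite !muE isom_outer_content.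
have [K [cK KU hK]] := inner_adherent hC U e0.
exists K; split => //; rewrite !muE -EFinD lee_fin outer_open//.
by rewrite (@le_trans _ _ (h K + e))// ?lerD2r ?content_le_outer// -lerBlDr ltW.
Qed.

End invariant_measure.

(** * Integrals of continuous functions against Borel probabilities *)

Section continuous_integrals.
Context (R : realType) (X : ptopologicalType).
Hypothesis cptX : compact [set: X].
Implicit Types (mu : probability (borel X) R) (f g : X -> R).

Lemma borel_open (U : set X) : open U -> measurable (U : set (borel X)).
Proof. by move=> oU; exact: sub_sigma_algebra. Qed.

Lemma borel_closed (K : set X) : closed K -> measurable (K : set (borel X)).
Proof.
move=> cK; have := measurableC (borel_open (closed_openC cK)).
by rewrite setCK.
Qed.

Lemma continuous_borel f : continuous f ->
  measurable_fun [set: borel X] (f : borel X -> R).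
Proof.
move=> /continuousP cf; apply: (measurability _ (RGenOInfty.measurableE R)).
move=> _ [_ [a ->] <-]; rewrite setTI set_itvoy.
exact: borel_open (cf _ (@open_gt R a)).
Qed.

Lemma continuous_bounded f : continuous f -> exists M, forall x, `|f x| <= M.
Proof.
move=> cf; have [M [_ HM]] : bounded_set (f @` [set: X]).
  apply: compact_bounded; apply: continuous_compact => //.
  exact: continuous_subspaceT.
by exists (M + 1) => x; apply: HM; [rewrite ltrDl|exists x].
Qed.

Lemma continuous_integrable mu f : continuous f ->
  mu.-integrable [set: borel X] (EFin \o (f : borel X -> R)).
Proof.
move=> cf; apply: measurable_bounded_integrable => //.
- by rewrite (le_lt_trans (probability_le1 _ _))// ltry.
- exact: continuous_borel.
- have [M HM] := continuous_bounded cf.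
  exists M; split; first exact: num_real.
  by move=> y My x _; exact: le_trans (HM x) (ltW My).
Qed.

Definition mean mu f : R := Rintegral mu [set: borel X] f.

Lemma mean_le mu f g : continuous f -> continuous g ->
  (forall x, f x <= g x) -> mean mu f <= mean mu g.
Proof.
move=> cf cg fg; apply: le_Rintegral => //; exact: continuous_integrable.
Qed.

Lemma mean_cst mu c : mean mu (fun=> c) = c.
Proof. rewrite /mean Rintegral_cst//.
have /= -> := probability_setT mu.
by rewrite mulr1. Qed.

Lemma meanD mu f g : continuous f -> continuous g ->
  mean mu (fun x => f x + g x) = mean mu f + mean mu g.
Proof. by move=> cf cg; apply: RintegralD => //; exact: continuous_integrable. Qed.

Lemma meanZ mu f c : continuous f -> mean mu (fun x => c * f x) = c * mean mu f.
Proof. by move=> cf; apply: RintegralZl => //; exact: continuous_integrable. Qed.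

(** With [mean_le_measure], this turns an equality of means into a comparison of a closed set with
    an open set around it. *)
Lemma measure_le_mean mu f (K : set X) : closed K -> continuous f ->
  (forall x, 0 <= f x) -> (forall x, K x -> 1 <= f x) ->
  (mu K <= (mean mu f)%:E)%E.
Proof.
move=> cK cf f0 f1; rewrite /mean /Rintegral fineK; last first.
  by apply: integrable_fin_num => //; exact: continuous_integrable.
rewrite -(setIT K) -[leLHS](integral_indic mu measurableT (borel_closed cK)).
apply: ge0_le_integral => //.
- by apply/measurable_EFinP; apply: measurable_indic; exact: borel_closed.
- by apply/measurable_EFinP; exact: continuous_borel.
- move=> x _; rewrite lee_fin indicE.
  by have [/set_mem/f1|_] := boolP (x \in K); rewrite ?f0.
Qed.

Lemma mean_le_measure mu f (U : set X) : open U -> continuous f ->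
  (forall x, 0 <= f x <= 1) -> (forall x, ~ U x -> f x = 0) ->
  ((mean mu f)%:E <= mu U)%E.
Proof.
move=> oU cf f01 f0; rewrite /mean /Rintegral fineK; last first.
  by apply: integrable_fin_num => //; exact: continuous_integrable.
rewrite -(setIT U) -[leRHS](integral_indic mu measurableT (borel_open oU)).
apply: ge0_le_integral => //.
- by move=> x _; rewrite lee_fin; case/andP: (f01 x).
- by apply/measurable_EFinP; exact: continuous_borel.
- by apply/measurable_EFinP; apply: measurable_indic; exact: borel_open.
- move=> x _; rewrite lee_fin indicE.
  have [_|/negP nUx] := boolP (x \in U); first by case/andP: (f01 x).
  by rewrite f0// => Ux; apply: nUx; rewrite inE.
Qed.

End continuous_integrals.

(** * Uniqueness of the means *)

Section equal_means.
Context (R : realType) (T : topologicalMonoidType) (X : ptopologicalType).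
Variable S : semiflow T X.
Hypothesis cptX : compact [set: X].
Hypothesis minS : minimal S.

Lemma act_measurable t :
  measurable_fun [set: borel X] (S t : borel X -> borel X).
Proof.
apply: (@measurability _ _ (borel X) (borel X) setT (S t) (@open X)) => //.
move=> _ [U oU <-]; rewrite setTI; apply: borel_open.
by apply: open_comp => // x _; exact: act_continuous.
Qed.

Lemma mean_act (mu : probability (borel X) R) (g : X -> R) t :
  invariant_probability S mu -> continuous g ->
  mean mu (fun x => g (S t x)) = mean mu g.
Proof.
move=> imu cg; rewrite /mean /Rintegral; congr fine.
have cgt : continuous (fun x => g (S t x)).
  move=> x; apply: (@continuous_comp _ _ _ (S t) g); last exact: cg.
  exact: act_continuous.
transitivity (\int[pushforward mu (S t : borel X -> borel X)]_(x in setT)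
    (EFin \o (g : borel X -> R)) x)%E.
  rewrite (integral_pushforward (act_measurable t))//=.
  - by apply/measurable_EFinP; exact: continuous_borel.
  - by have := continuous_integrable cptX mu cgt.
apply: eq_measure_integral => [|mt A mA _]; first exact: act_measurable.
exact: esym (imu t A mA).
Qed.

(** Minimality gives a time for each pair; it works near that pair, so compactness of the square
    leaves finitely many times. *)
Lemma uniform_return (d : X -> X -> R) (r : R) : pseudometric_on d -> 0 < r ->
  exists ts : seq T, forall x y, exists2 t, t \in ts & d y (S t x) < r.
Proof.
move=> pmd r0; have r20 : 0 < r / 2 by rewrite divr_gt0.
(* Finite lists directed by inclusion: eventually along [F] a list contains any prescribed time. *)
pose F := filter_from [set: seq T] (fun s => [set s' : seq T | {subset s <= s'}]).
have FF : Filter F.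
  apply: filter_from_filter; first by exists [::].
  move=> s1 s2 _ _; exists (s1 ++ s2) => // s Hs; split=> t ts; apply: Hs;
  by rewrite mem_cat ts ?orbT.
have cXX : compact ([set: X] `*` [set: X]) by exact: compact_setX.
have [|s _ Hs] := (compact_near_coveringP _).1 cXX _ F
  (fun s p => exists2 t, t \in s & d p.2 (S t p.1) < r) FF _; last first.
  exists s => x y; exact: (Hs s (fun _ => id) (x, y)).
move=> [x y] _.
have yy : [set z | d y z < r / 2] y by rewrite /= pmxx.
have [z [yz [t _ tz]]] := minS x (ex_intro _ y yy)
  (pm_open_ball pmd y (r / 2)).
exists ([set x' | d y (S t x') < r / 2] `*` [set y' | d y y' < r / 2],
        [set s : seq T | t \in s]) => /=.
  split.
    exists ([set x' | d y (S t x') < r / 2], [set y' | d y y' < r / 2]) => //=.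
    split; last exact: pm_near.
    apply: open_nbhs_nbhs; split; last by rewrite /= tz.
    apply: (@open_comp _ _ (S t) [set z | d y z < r / 2]);
      last exact: (pm_open_ball pmd y (r / 2)).
    by move=> ? _; exact: act_continuous.
  by exists [:: t] => // s; apply; rewrite mem_head.
move=> [[x' y'] s] [[/= Hx Hy] ts]; exists t => //=.
by rewrite (le_lt_trans (pm_tri pmd y _ _))// [ltRHS]splitr ltrD// pmC.
Qed.

Lemma sum_le_drop (s : seq T) (a : T -> R) (M c : R) t : t \in s ->
  (forall u, a u <= M) -> a t <= M - c ->
  \sum_(u <- s) a u <= (size s)%:R * M - c.
Proof.
move=> + aM at_le; elim: s => // u s IH; rewrite inE big_cons /=.
rewrite -natr1 mulrDl mul1r => /orP[/eqP <-|/IH sM].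
  suff : \sum_(j <- s) a j <= (size s)%:R * M by lra.
  elim: s {IH} => [|v s IHs]; first by rewrite big_nil mul0r.
  by rewrite big_cons /= -natr1 mulrDl mul1r addrC lerD.
by have := aM u; lra.
Qed.

Variables (mu nu : probability (borel X) R).
Hypothesis imu : invariant_probability S mu.
Hypothesis inu : invariant_probability S nu.

(** The competitors in a minimization: averaging over translates preserves these conditions when [d]
    and both measures are invariant. *)
Let admissible (f : X -> R) (d : X -> X -> R) (g : X -> R) :=
  [/\ continuous g, forall x y, `|g x - g y| <= d x y,
      mean mu g = mean mu f & mean nu g = mean nu f].

Let admissible_average f d g (ts : seq T) :
  (forall t x y, d (S t x) (S t y) = d x y) -> (0 < size ts)%N ->
  admissible f d g ->
  admissible f d (fun x => (size ts)%:R^-1 * \sum_(t <- ts) g (S t x)).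
Proof.
move=> dS n0 [cg gd gmu gnu].
have cgt t : continuous (fun x => g (S t x)).
  move=> x; apply: (@continuous_comp _ _ _ (S t) g); last exact: cg.
  exact: act_continuous.
have nn : (size ts)%:R != 0 :> R by rewrite pnatr_eq0 -lt0n.
pose sg s x := \sum_(t <- s) g (S t x).
have sg_cons t s : sg (t :: s) = fun x => g (S t x) + sg s x.
  by apply/funext => x; rewrite /sg big_cons.
have csg s : continuous (sg s).
  elim: s => [|t s IH].
    have -> : sg [::] = fun=> 0 by apply/funext => x; rewrite /sg big_nil.
    by move=> x; exact: cvg_cst.
  by rewrite sg_cons => x; apply: cvgD; [exact: cgt|exact: IH].
have msg (m : probability (borel X) R) s : invariant_probability S m ->
    mean m (sg s) = (size s)%:R * mean m g.
  move=> im; elim: s => [|t s IH].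
    have -> : sg [::] = fun=> 0 by apply/funext => x; rewrite /sg big_nil.
    by rewrite mean_cst mul0r.
  by rewrite sg_cons meanD// IH mean_act// /= -natr1 mulrDl mul1r addrC.
have dsg s x y : `|sg s x - sg s y| <= (size s)%:R * d x y.
  elim: s => [|t s IH]; first by rewrite /sg !big_nil subrr normr0 mul0r.
  rewrite sg_cons opprD addrACA (le_trans (ler_normD _ _))//=.
  rewrite -natr1 mulrDl mul1r [leRHS]addrC lerD//.
  by rewrite -(dS t); exact: gd.
split.
- by move=> x; apply: cvgMr; exact: csg.
- move=> x y; rewrite -mulrBr normrM ger0_norm ?invr_ge0//.
  by rewrite ler_pdivrMl ?ltr0n//; exact: dsg.
- by rewrite (meanZ cptX mu _ (csg ts)) msg// mulKf.
- by rewrite (meanZ cptX nu _ (csg ts)) msg// mulKf.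
Qed.

(* Averaging over a finite set of translates that reaches every ball lowers
   the maximum of any admissible function with large oscillation by a fixed
   amount, so an almost optimal admissible function is almost constant. *)
Lemma invariant_mean_eq (f : X -> R) (d : X -> X -> R) : continuous f ->
  pseudometric_on d -> (forall t x y, d (S t x) (S t y) = d x y) ->
  (forall x y, `|f x - f y| <= d x y) -> mean mu f = mean nu f.
Proof.
move=> cf pmd dS fd; apply/eqP; rewrite -subr_eq0 -normr_eq0.
apply/negPn/negP => nz.
(* Half the gap: means confined to an interval of length [e] cannot differ by [2 * e]. *)
have e0 : 0 < `|mean mu f - mean nu f| / 2.
  by rewrite divr_gt0// lt_neqAle eq_sym nz normr_ge0.
set e := _ / 2 in e0; have e20 : 0 < e / 2 by rewrite divr_gt0.
have [ts tsP] := uniform_return pmd e20.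
have n0 : (0 < size ts)%N by have [t] := tsP point point; case: (ts).
pose M (g : X -> R) := sup (range g).
have M_sup (g : X -> R) : continuous g -> has_sup (range g).
  move=> cg; split; first by exists (g point); exists point.
  have [B HB] := continuous_bounded cptX cg.
  by exists B => _ [x _ <-]; exact: le_trans (ler_norm _) (HB x).
have M_ub (g : X -> R) x : continuous g -> g x <= M g.
  by move=> cg; apply: ub_le_sup; [case: (M_sup g cg)|exists x].
have M_le (g : X -> R) c : continuous g -> (forall x, g x <= c) -> M g <= c.
  by move=> cg gc; apply: ge_sup; [case: (M_sup g cg)|move=> _ [x _ <-]].
pose E := [set M g | g in admissible f d].
have Einf : has_inf E.
  split; first by exists (M f); exists f.
  exists (mean mu f) => _ [g [cg _ <- _] <-].
  rewrite -(mean_cst mu (M g)); apply: mean_le => //; first by move=> ?; exact: cvg_cst.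
  by move=> x; exact: M_ub.
have nR0 : 0 < (size ts)%:R :> R by rewrite ltr0n.
(* The drop of the maximum under averaging when some [g y] is below [M g - e]: at each point one of
   the [size ts] translates is then at least [e / 2] under [M g]. *)
have e2n0 : 0 < e / 2 / (size ts)%:R by rewrite divr_gt0.
have [_ [g ag <-] gE] := inf_adherent e2n0 Einf.
have [cg gd gmu gnu] := ag.
have osc y : M g - e <= g y.
  rewrite leNgt; apply/negP => gy.
  have := admissible_average dS n0 ag; set g' := (fun x => _ * _) => ag'.
  have cg' : continuous g' by case: ag'.
  have : M g' <= M g - e / 2 / (size ts)%:R.
    apply: M_le => // x; rewrite ler_pdivrMl// mulrBr mulrCA divff ?gt_eqF// mulr1.
    have [t tts ty] := tsP x y.
    apply: (sum_le_drop tts) => [u|]; first exact: M_ub.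
    have := le_lt_trans (gd y (S t x)) ty; rewrite ltr_norml => /andP[].
    by lra.
  have : inf E <= M g' by apply: ge_inf; [case: Einf|exists g'].
  by lra.
have mean_bounds (m : probability (borel X) R) : M g - e <= mean m g <= M g.
  apply/andP; split.
    rewrite -{1}(mean_cst m (M g - e)); apply: mean_le => // ?; exact: cvg_cst.
  rewrite -[leRHS](mean_cst m (M g)); apply: mean_le => //; first by move=> ?; exact: cvg_cst.
  by move=> x; exact: M_ub.
have := mean_bounds mu; have := mean_bounds nu; rewrite gmu gnu.
move=> /andP[a1 a2] /andP[b1 b2].
have : `|mean mu f - mean nu f| <= e by rewrite ler_norml; lra.
rewrite leNgt => /negP; apply.
by rewrite /e ltr_pdivrMr// ltr_pMr ?ltr1n// lt_neqAle eq_sym nz normr_ge0.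
Qed.

End equal_means.

(** * Completion regularity *)

Section completion_regularity.
Context (R : realType) (X : ptopologicalType) (D : set (X -> X -> R)).
Hypothesis cptX : compact [set: X].
Hypothesis hausX : hausdorff_space X.
Hypothesis famD : separating_family D.
Hypothesis homD : homogeneous_for D.

Notation isom := (isometry_for D).

Let pmD d : D d -> pseudometric_on d.
Proof. by case: famD => + _ _; apply. Qed.

(** Isometries are equicontinuous, so closeness on a finite [r / 3]-net spreads to all points. *)
Lemma isom_limit_uniform (I : Type) (G : set_system I) (p : I -> X -> X)
    (q : X -> X) (d : X -> X -> R) (r : R) :
  UltraFilter G -> (forall i, isom (p i)) -> isom q ->
  (forall x, p i x @[i --> G] --> q x) -> D d -> 0 < r ->
  G [set i | forall z, d (p i z) (q z) < r].
Proof.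
move=> UG ip iq pq Dd r0; have pmd := pmD Dd.
have r30 : 0 < r / 3 by rewrite divr_gt0.
have [L LP] := pm_net pmd cptX r30.
have GL : G [set i | forall z, z \in L -> d (q z) (p i z) < r / 3].
  elim: L {LP} => [|z L IH]; first by apply: filterE => i z.
  have Gz : G [set i | d (q z) (p i z) < r / 3] := pq z _ (pm_near pmd (q z) r30).
  apply: filterS (filterI Gz IH) => i [/= iz iL] y.
  by rewrite inE => /orP[/eqP->//|/iL].
apply: filterS GL => i /= iL z; have [y yL zy] := LP z.
have := pm_tri pmd (p i y) (p i z) (q z); have := pm_tri pmd (q y) (p i y) (q z).
have := iL y yL; rewrite (pmC pmd (q y) (p i y)) (ip i d Dd) (iq d Dd).
rewrite (pmC pmd y z); lra.
Qed.

(** Were this false, isometries [p y] from [a] to bad points [y] near [a] would converge along an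
    ultrafilter, uniformly for [d], to some [q] fixing [a]; then [q] after the inverse of [p y] is
    the required small motion. *)
Lemma small_transport (d : X -> X -> R) (r : R) (a : X) : D d -> 0 < r ->
  \forall y \near a, exists q, [/\ isom q, q y = a & forall z, d (q z) z < r].
Proof.
move=> Dd r0; have pmd := pmD Dd; apply: contrapT => na.
pose B := [set y | ~ exists q, [/\ isom q, q y = a & forall z, d (q z) z < r]].
have PF : ProperFilter (within B (nbhs a)).
  apply: within_nbhs_proper => C aC; apply: contrapT => BC; apply: na.
  apply: filterS aC => y Cy; apply: contrapT => By; apply: BC; by exists y.
have [G [UG FG]] := ultraFilterLemma PF.
have GB : G B by apply: FG; exact: withinT.
have Ga : G --> a by move=> C aC; apply: FG; apply: filterS aC.
have [p pP] := choice (fun y => let: ex_intro2 q iq qa := homD a y in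
  ex_intro (fun q => isom q /\ q a = y) q (conj iq qa)).
have [q iq Gq] := isom_ultra_limit cptX famD UG (fun y => (pP y).1).
have qa : q a = a.
  apply: (cvg_unique hausX (Gq a)).
  by have -> : (fun i => p i a) = id by apply/funext => i; rewrite (pP i).2.
have := isom_limit_uniform UG (fun y => (pP y).1) iq Gq Dd r0.
move=> /(filterI GB) /filter_ex[y [/= By Hy]]; apply: By.
have [p' [ip' pp' p'p]] := isom_inverse cptX hausX famD (pP y).1.
exists (q \o p'); split; first exact: isom_comp.
  by rewrite /= -{1}(pP y).2 pp' qa.
by move=> z /=; rewrite (pmC pmd) -{1}(p'p z).
Qed.

Variables (lam mu : probability (borel X) R).
Hypothesis lam_isom : forall p A, isom p -> lam (p @` A) = lam A.
Hypothesis lam_regular : forall U e, open U -> 0 < e ->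
  exists K, [/\ closed K, K `<=` U & (lam U <= lam K + e%:E)%E].
Hypothesis mean_eq : forall f, continuous f -> mean mu f = mean lam f.

Lemma lam_preimage p (A : set X) : isom p -> lam (p @^-1` A) = lam A.
Proof.
move=> ip; have [q [iq pq qp]] := isom_inverse cptX hausX famD ip.
rewrite -(lam_isom A iq); congr (lam _); apply/seteqP; split => [x Ax|_ [x Ax <-]].
  by exists (p x).
by rewrite /= qp.
Qed.

(** A Urysohn function between a nearly full closed subset of [U] and the complement compares [lam]
    with [mu] by their common mean. *)
Lemma regular_le_open (U : set X) : open U -> (lam U <= mu U)%E.
Proof.
move=> oU; apply/lee_addgt0Pr => e e0.
have [K [cK KU lUK]] := lam_regular oU e0.
apply: (le_trans lUK); rewrite leeD2r//.
have [|f [cf f01 f0 f1]] := @urysohn_function R X (~` U) K cptX hausX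
    (open_closedC oU) cK.
  by apply/seteqP; split => // x [nU /KU].
apply: (@le_trans _ _ (mean lam f)%:E).
  apply: measure_le_mean => // x; first by case/andP: (f01 x).
  by move=> /f1->.
by rewrite -mean_eq//; apply: mean_le_measure.
Qed.

Lemma probability_diff_le (m : probability (borel X) R) (K U : set (borel X)) e :
  measurable K -> measurable U -> K `<=` U -> (m U <= m K + e)%E ->
  (m (U `\` K) <= e)%E.
Proof.
move=> mK mU KU mUK; rewrite measureD//; last first.
  by rewrite (le_lt_trans (probability_le1 _ _))// ltry.
rewrite setIidr// leeBlDl// fin_numElt.
rewrite (lt_le_trans _ (measure_ge0 _ _)) ?ltNyr//=.
by rewrite (le_lt_trans (probability_le1 _ _))// ltry.
Qed.

(* If [f n] are Urysohn functions exhausting [U] up to a null set, the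
   isometries preserving every [f n] move [U] only within a null set, and the
   union [W] of the translates of [U] is a countable union of sets whose
   measure is controlled by integrals of continuous functions. *)
Section open_set.
Variable U : set X.
Hypothesis oU : open U.
Variable f : nat -> X -> R.
Hypothesis cf : forall n, continuous (f n).
Variable K : nat -> set X.
Hypothesis cK : forall n, closed (K n).
Hypothesis KU : forall n, K n `<=` U.
Hypothesis lamK : forall n, (lam U <= lam (K n) + (n.+1%:R^-1)%:E)%E.
Hypothesis fK : forall n x, K n x -> 0 < f n x.
Hypothesis fU : forall n x, 0 < f n x -> U x.
Variable c : nat -> X -> X -> R.
Hypothesis Dc : forall n, D (c n).
Hypothesis fc : forall n x y, `|f n x - f n y| <= c n x y.
Hypothesis c_homo : forall m n x y, (m <= n)%N -> c m x y <= c n x y.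

Let V := [set x | exists n, 0 < f n x].

(** The kernel of the action of isometries on the quotient of [X] by the vanishing of all [c n]; [W]
    is the saturation of [U] under it. *)
Let N p := isom p /\ forall n z, c n (p z) z = 0.

Let W := [set x | exists2 p, N p & U (p x)].

Let UW : U `<=` W.
Proof.
by move=> x Ux; exists id => //; split => // n z; rewrite pmxx//; exact/pmD/Dc.
Qed.

Let oW : open W.
Proof.
have -> : W = \bigcup_(p in N) (p @^-1` U).
  by apply/seteqP; split => x [p Np Ux]; exists p.
apply: bigcup_open => p [ip _]; apply: open_comp => // x _.
exact: (isom_continuous cptX hausX famD ip).
Qed.

Let oV : open V.
Proof.
have -> : V = \bigcup_n (f n @^-1` [set y | 0 < y]).
  by apply/seteqP; split => [x [n fn]|x [n _ fn]]; exists n.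
apply: bigcup_open => n _; apply: open_comp; last exact: open_gt.
by move=> x _; exact: cf.
Qed.

Let VU : V `<=` U. Proof. by move=> x [n /fU]. Qed.

Let N_V p x : N p -> V (p x) -> V x.
Proof.
move=> [ip pc] [n fn]; exists n.
by have := fc n (p x) x; rewrite pc normr_le0 subr_eq0 => /eqP<-.
Qed.

Let UV_null : lam (U `\` V) = 0%E.
Proof.
apply/eqP; rewrite eq_le measure_ge0 andbT; apply/lee_addgt0Pr => e e0.
rewrite add0e.
have [n ne] : exists n, n.+1%:R^-1 < e.
  by have [n _ /(_ n (leqnn n))] := near_infty_natSinv_lt (PosNum e0); exists n.
apply: (@le_trans _ _ (n.+1%:R^-1)%:E); last by rewrite lee_fin ltW.
have UK := probability_diff_le (borel_closed (@cK n)) (borel_open oU)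
  (@KU n) (lamK n).
apply: (le_trans _ UK); apply: le_measure; rewrite ?inE.
- by apply: measurableD; exact: borel_open.
- by apply: measurableD; [exact: borel_open|exact: borel_closed].
- by move=> x [Ux nV]; split => // /fK fn; apply: nV; exists n.
Qed.

(** Finitely many preimages of [U] under members of [N] cover the compact set; as [V] is invariant,
    each contributes only a preimage of the null set [U] minus [V]. *)
Let compact_null (L : set X) : closed L -> L `<=` W -> lam (L `\` V) = 0%E.
Proof.
move=> cL LW.
have cLV : closed (L `\` V) by apply: closedI => //; exact: open_closedC.
have kLV : compact (L `\` V) by exact: subclosed_compact cLV cptX _.
pose null : set (set X) :=
  [set A | measurable (A : set (borel X)) /\ lam A = 0%E].
pose F := filter_from null (fun A => [set B : set X | A `<=` B]).
have FF : Filter F.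
  apply: filter_from_filter;
    first by exists set0; split; [exact: measurable0|exact: measure0].
  move=> A B [mA nA] [mB nB]; exists (A `|` B).
    by split; [exact: measurableU|exact: null_set_setU].
  by move=> C ABC; split=> x ?; apply: ABC; [left|right].
have := (near_covering_withinP _).2 ((compact_near_coveringP _).1 kLV).
move=> /(_ _ F (fun A x => A x) FF) [|A [mA nA] HA]; last first.
  apply: (@subset_measure0 _ _ _ lam _ A) => //; first exact: borel_closed.
  exact: (HA A).
move=> x [/LW[p Np Upx] nVx].
have mp : measurable (p @^-1` (U `\` V) : set (borel X)).
  have op O : open O -> open (p @^-1` O).
    move=> oO; apply: open_comp => // y _.
    by case: Np => ip _; exact: (isom_continuous cptX hausX famD ip).
  by apply: (@measurableD _ (borel X) (p @^-1` U) (p @^-1` V));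
     apply: borel_open; exact: op.
exists (p @^-1` U, [set B | p @^-1` (U `\` V) `<=` B]) => /=.
  split; last first.
    by exists (p @^-1` (U `\` V)) => //; split => //; rewrite lam_preimage//; case: Np.
  apply: open_nbhs_nbhs; split => //; apply: open_comp => // y _.
  by case: Np => ip _; exact: (isom_continuous cptX hausX famD ip).
move=> [y B] [/= Uy pB] [_ nVy]; apply: pB; split => // Vpy; apply: nVy.
exact: N_V Vpy.
Qed.

Let lamWU : (lam W <= lam U)%E.
Proof.
apply/lee_addgt0Pr => e e0.
have [L [cL LW lWL]] := lam_regular oW e0.
apply: (le_trans lWL); rewrite leeD2r//.
apply: (@le_trans _ _ (lam ((L `\` V) `|` V))).
  apply: le_measure; rewrite ?inE.
  - exact: borel_closed.
  - by apply: measurableU; [apply: measurableD; [exact: borel_closed|]|];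
       exact: borel_open.
  - by move=> x Lx; have [Vx|nVx] := pselect (V x); [right|left].
rewrite (le_trans (measureU2 _ _ _))//.
- by apply: measurableD; [exact: borel_closed|exact: borel_open].
- exact: borel_open.
rewrite [X in (X + _)%E](compact_null cL LW) add0e.
by apply: le_measure; rewrite ?inE//; exact: borel_open.
Qed.

(** Neighbourhoods of the complement of [W] that shrink to it; they show that [W] is a countable
    union of closed sets. *)
Let O k := [set y | exists q, [/\ isom q,
  forall z, c k (q z) z < k.+1%:R^-1 & (~` W) (q y)]].

Let cW_O k : ~` W `<=` interior (O k).
Proof.
move=> a nWa; have k0 : 0 < k.+1%:R^-1 :> R by rewrite invr_gt0.
apply: filterS (small_transport a (Dc k) k0) => y [q [iq qy qz]].
by exists q; rewrite qy.
Qed.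

Let capO y : (forall k, O k y) -> (~` W) y.
Proof.
move=> /choice[q qP] [p [ip pc] Upy].
have [G [UG oG]] := ultraFilterLemma eventually_filter.
have iqk k : isom (q k) by case: (qP k).
(* A limit [s] of the small motions has zero displacement for every [c n], so it lies in [N], and it
   sends [y] outside the open set [W]; but [W] is invariant under [N]. *)
have [s is_ Gs] := isom_ultra_limit cptX famD UG iqk.
have nWs : (~` W) (s y).
  apply: (@closed_cvg _ _ G _ (fun k => q k y) (~` W)) (Gs y).
    exact: open_closedC.
  by apply: filterE => k; case: (qP k).
apply: nWs; have [s' [is' ss' s's]] := isom_inverse cptX hausX famD is_.
exists (p \o s'); last by rewrite /= ss'.
split => [|n z /=]; first exact: isom_comp.
have pmc := pmD (Dc n).
apply/eqP; rewrite eq_le pm_ge0// andbT.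
suff : c n (s' z) z <= 0.
  by have := pm_tri pmc (s' z) (p (s' z)) z; rewrite pc add0r => /le_trans; apply.
rewrite -(is_ (c n) (Dc n)) s's.
apply/ler_addgt0Pr => e e0; rewrite add0r.
have e20 : 0 < e / 2 by rewrite divr_gt0.
have G1 := isom_limit_uniform UG iqk is_ Gs (Dc n) e20.
have G2 : G [set k | k.+1%:R^-1 < e / 2 /\ (n <= k)%N].
  apply: oG; near=> k; split; last by near: k; exists n.
  by near: k; exact: near_infty_natSinv_lt (PosNum e20).
have [k [/= H1 [H2 nk]]] := filter_ex (filterI G1 G2).
have [_ /(_ z)/lt_trans/(_ H2) qk _] := qP k.
have := H1 z; have := @c_homo _ _ (q k z) z nk.
have := pm_tri pmc (q k z) z (s z); rewrite (pmC pmc z (s z)) (pmC pmc z (q k z)).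
lra.
Unshelve. all: by end_near. Qed.

(** Continuity from below reduces to the closed sets [C k] inside [W], where a Urysohn function
    compares the two measures through a common mean. *)
Let muW : (mu W <= lam W)%E.
Proof.
pose C k := ~` interior (O k).
have cC k : closed (C k) by exact/open_closedC/open_interior.
have WE : W = \bigcup_k C k.
  apply/seteqP; split => [x Wx|x [k _ nO]]; last first.
    by apply: contrapT => nWx; apply: nO; exact: cW_O.
  apply: contrapT => nC; apply: (capO _ Wx) => k; apply: contrapT => nO.
  by apply: nC; exists k => // /interior_subset.
have ndC : nondecreasing_seq C.
  move=> m n mn; apply/subsetPset; apply: subsetC; apply: interiorS => y.
  move=> [q [iq qz qy]]; exists q; split => // z.
  rewrite (le_lt_trans (c_homo _ _ mn))// (lt_le_trans (qz z))//.
  by rewrite lef_pV2 ?posrE// ler_nat.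
have mC k : measurable (C k : set (borel X)) by exact: borel_closed.
have := @nondecreasing_cvg_mu _ (borel X) R mu C mC
  (@bigcupT_measurable _ (borel X) C mC) ndC.
rewrite -WE => muC; apply: (cvge_to_le muC); apply: filterE => k /=.
have [|g [cg g01 g0 g1]] := @urysohn_function R X (~` W) (C k) cptX hausX
    (open_closedC oW) (cC k).
  by apply/seteqP; split => // x [/cW_O Ox nOx]; exact: nOx.
apply: (@le_trans _ _ (mean mu g)%:E).
  apply: (measure_le_mean cptX mu (cC k) cg) => x; first by case/andP: (g01 x).
  by move=> /g1->.
rewrite mean_eq//; apply: (mean_le_measure cptX lam oW cg g01) => x nWx.
exact: g0.
Qed.

Lemma open_le_regular : (mu U <= lam U)%E.
Proof.
apply: le_trans lamWU; apply: le_trans muW.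
by apply: le_measure; rewrite ?inE//; exact: borel_open.
Qed.

End open_set.

End completion_regularity.

(** * Agreement on Borel sets and unique ergodicity *)

Lemma probability_eq_regular (R : realType) (X : ptopologicalType)
    (D : set (X -> X -> R)) (lam mu : probability (borel X) R) :
  compact [set: X] -> hausdorff_space X -> separating_family D ->
  homogeneous_for D ->
  (forall p A, isometry_for D p -> lam (p @` A) = lam A) ->
  (forall U e, open U -> 0 < e ->
     exists K, [/\ closed K, K `<=` U & (lam U <= lam K + e%:E)%E]) ->
  (forall f, continuous f -> mean mu f = mean lam f) ->
  forall B : set (borel X), measurable B -> mu B = lam B.
Proof.
move=> cX hX famD homD lam_isom lam_reg mean_eq.
(* Open sets are stable under intersection and generate the Borel sets, so agreement on them is
   enough. *)
apply: (@measure_unique _ R (borel X) (@open X) (fun=> setT)) => //.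
- by move=> A B; exact: openI.
- by move=> _; exact: openT.
- by rewrite bigcup_const.
- move=> U oU; apply/eqP; rewrite eq_le; apply/andP; split; last first.
    exact: (regular_le_open cX hX lam_reg mean_eq).
  have e0 n : 0 < n.+1%:R^-1 :> R by rewrite invr_gt0.
  have [K KP] := choice (fun n => lam_reg U _ oU (e0 n)).
  have cK n : closed (K n) by case: (KP n).
  have KU n : K n `<=` U by case: (KP n).
  have fex n : exists f : X -> R, [/\ continuous f, forall x, 0 <= f x <= 1,
      forall x, (~` U) x -> f x = 0 & forall x, K n x -> f x = 1].
    apply: (@urysohn_function R X _ _ cX hX (open_closedC oU) (cK n)).
    by apply/seteqP; split => // x [nUx /KU].
  have [f fP] := choice fex.
  have [pmD DD Dsep] := famD.
  have dex n : exists d, D d /\ forall x y, `|f n x - f n y| <= d x y.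
    by have [cf _ _ _] := fP n; have [d Dd df] := Dsep _ cf; exists d.
  have [d dP] := choice dex.
  (* Partial sums give a monotone sequence in [D]; they start with one term because [D] is closed
     under sums but need not contain 0. *)
  pose c n x y := \sum_(i < n.+1) d i x y.
  have cS n x y : c n.+1 x y = c n x y + d n.+1 x y by rewrite /c big_ord_recr.
  have Dc n : D (c n).
    elim: n => [|n IH].
      suff -> : c 0%N = d 0%N by case: (dP 0%N).
      by apply/funext => x; apply/funext => y; rewrite /c big_ord1.
    suff -> : c n.+1 = fun x y => c n x y + d n.+1 x y.
      by apply: DD => //; case: (dP n.+1).
    by apply/funext => x; apply/funext => y; rewrite cS.
  have d_ge0 n x y : 0 <= d n x y by apply: pm_ge0; apply: pmD; case: (dP n).
  have c_homo m n x y : (m <= n)%N -> c m x y <= c n x y.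
    elim: n => [|n IH]; first by rewrite leqn0 => /eqP->.
    rewrite leq_eqVlt => /orP[/eqP->//|]; rewrite ltnS => /IH.
    by rewrite cS => /le_trans; apply; rewrite lerDl.
  have fc n x y : `|f n x - f n y| <= c n x y.
    rewrite (le_trans ((dP n).2 x y))// /c big_ord_recr /= lerDr.
    by apply: sumr_ge0 => i _.
  apply: (open_le_regular cX hX famD homD lam_isom lam_reg mean_eq oU
    (f := f) _ cK KU _ _ _ Dc fc c_homo).
  + by move=> n; case: (fP n).
  + by move=> n; case: (KP n).
  + by move=> n x Kx; have [_ _ _ ->] := fP n.
  + move=> n x fx; apply: contrapT => nUx.
    by move: fx; have [_ _ -> // _] := fP n; rewrite ltxx.
- by move=> _; rewrite (le_lt_trans (probability_le1 _ _))// ltry.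
Qed.

Theorem theorem3p5 (R : realType) (T : topologicalMonoidType)
    (X : ptopologicalType) (S : semiflow T X) :
  compact [set: X]%classic ->
  hausdorff_space X ->
  right_C_semigroup T ->
  minimal S ->
  weakly_almost_periodic S R ->
  (forall t : T, set_surj [set: X]%classic [set: X]%classic (S t)) ->
  uniquely_ergodic S R.
Proof.
move=> cX hX rT mS wS sS.
have famD := invariant_pseudometrics_separating cX rT mS wS sS.
have homD := invariant_pseudometrics_homogeneous cX hX rT mS wS sS.
have [lam [lam_isom lam_reg]] := invariant_regular_probability cX hX famD.
have ilam : invariant_probability S lam.
  move=> t B _; apply/esym.
  exact: (lam_preimage cX hX famD lam_isom B (act_isometry t)).
exists lam => // nu inu B mB.
apply: (probability_eq_regular cX hX famD homD lam_isom lam_reg) => // f cf.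
(* The variation of [f] is dominated by an invariant pseudometric, to which averaging applies. *)
have [_ _ /(_ f cf)[d [pmd dS] fd]] := famD.
exact: (invariant_mean_eq cX mS inu ilam cf pmd dS fd).
Qed.
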